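(* Let $\mathbb{X}$ be a real Banach space. Then the following statements are equivalent: (i) $\mathbb{X}$ is an Asplund space; (ii) for every finite family $\{A_1,\dots,A_m\}$ of nonempty closed subsets of $\mathbb{X}$ which is subtransversal at a point $\bar x\in A_1\cap\dots\cap A_m$, there exists $\delta\in(0,+\infty)$ such that for any $\varepsilon>0$ the inclusion $$\hat N(A_1\cap\dots\cap A_m,x)\subset\bigcup\Big\{\sum_{i=1}^m\hat N(A_i,x_i): x_i\in A_i\cap \mathbf{B}(x,\varepsilon),\ i=1,\dots,m\Big\}+\varepsilon\mathbf{B}_{\mathbb{X}^*}$$ holds for all $x\in A_1\cap\dots\cap A_m\cap\mathbf{B}(\bar x,\delta)$; (iii) for every finite family $\{A_1,\dots,A_m\}$ of nonempty closed subsets of $\mathbb{X}$ which is subtransversal at a point $\bar x\in A_1\cap\dots\cap A_m$ and for any $\varepsilon>0$, one has $$\hat N(A_1\cap\dots\cap A_m,\bar x)\subset\bigcup\Big\{\sum_{i=1}^m\hat N(A_i,x_i): x_i\in A_i\cap \mathbf{B}(\bar x,\varepsilon),\ i=1,\dots,m\Big\}+\varepsilon\mathbf{B}_{\mathbb{X}^*}.$$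
   Context: $\mathbb{X}^*$ is the topological dual of $\mathbb{X}$; $\mathbf{B}_{\mathbb{X}^*}$ is the closed unit ball of $\mathbb{X}^*$; $\mathbf{B}(x,r)$ is the open ball in $\mathbb{X}$ with center $x$ and radius $r$; $\mathbf{d}(x,S)=\inf_{y\in S}\|x-y\|$. A Banach space is Asplund if every continuous convex function on it is Fréchet differentiable at each point of a dense subset. For a closed set $A\subseteq\mathbb{X}$ and $x\in A$, the Fréchet normal cone is $\hat N(A,x)=\{x^*\in\mathbb{X}^*:\limsup_{y\to x,\,y\in A}\frac{\langle x^*,y-x\rangle}{\|y-x\|}\le 0\}$. A finite collection of closed sets $\{A_1,\dots,A_m\}$ is subtransversal at $\bar x\in A:=\bigcap_{i=1}^mA_i$ if there exist $\tau,r\in(0,+\infty)$ such that $\mathbf{d}(x,A)\le\tau\sum_{i=1}^m\mathbf{d}(x,A_i)$ for all $x\in\mathbf{B}(\bar x,r)$. *)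

(* Defs.v *)
From mathcomp Require Import all_boot all_order all_algebra.
From mathcomp Require Import all_classical all_reals all_analysis.

Set Implicit Arguments.
Unset Strict Implicit.
Unset Printing Implicit Defensive.

Import Order.TTheory GRing.Theory Num.Theory.
Import numFieldNormedType.Exports.

Local Open Scope classical_set_scope.
Local Open Scope ring_scope.

Definition asplund (R : realType) (X : completeNormedModType R) : Prop :=
  forall f : X -> R^o,
    continuous f -> @convex_function R X [set: X] f ->
    exists2 D : set X, dense D & forall x, D x -> differentiable f x.

(* The topological dual is a set of functions; sums and multiples of
   functionals are the pointwise operations on X -> R^o. *)
Definition dual (R : realType) (X : normedModType R) : set (X -> R^o) :=
  [set f | linear f /\ continuous f].

Arguments dual {R} X.

(* The set under [sup] is bounded when f is in [dual X]; for an unbounded set,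
   [sup] takes the default value 0. *)
Definition dual_norm (R : realType) (X : normedModType R) (f : X -> R^o) : R :=
  sup [set `|f x| | x in [set x : X | `|x| <= 1]].

Definition dual_unit_ball (R : realType) (X : normedModType R) :
    set (X -> R^o) :=
  [set f | dual X f /\ dual_norm f <= 1].

Arguments dual_unit_ball {R} X.

(* [inf] is real-valued, with default value 0 when S is empty. *)
Definition dist_set (R : realType) (X : normedModType R) (x : X) (S : set X) :
    R :=
  inf [set `|x - y| | y in S].

(* The filter is that of the punctured neighbourhoods of x in A; if x is
   isolated in A, the limsup is -oo and the cone is the whole dual. *)
Definition frechet_normal_cone (R : realType) (X : normedModType R)
    (A : set X) (x : X) : set (X -> R^o) :=
  [set xs | dual X xs /\
    (limf_esup (fun y : X => (xs (y - x) / `|y - x|)%:E) (within A x^')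
       <= 0%:E)%E].

Definition subtransversal (R : realType) (X : normedModType R) (m : nat)
    (A : 'I_m -> set X) (xbar : X) : Prop :=
  exists tau r : R, [/\ 0 < tau, 0 < r &
    forall x, ball xbar r x ->
      dist_set x (\bigcap_i A i) <= tau * \sum_(i < m) dist_set x (A i)].

Definition minkowski_sum (V : nmodType) (m : nat) (C : 'I_m -> set V) : set V :=
  [set \sum_(i < m) v i | v in [set v : 'I_m -> V | forall i, C i (v i)]].

Definition enlargement (R : realType) (X : normedModType R)
    (C : set (X -> R^o)) (eps : R) : set (X -> R^o) :=
  [set u + eps *: b | u in C & b in dual_unit_ball X].

Definition fuzzy_cone_sum (R : realType) (X : normedModType R) (m : nat)
    (A : 'I_m -> set X) (x : X) (eps : R) : set (X -> R^o) :=
  \bigcup_(xi in [set xi : 'I_m -> X |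
                   forall i, (A i `&` ball x eps) (xi i)])
    minkowski_sum (fun i => frechet_normal_cone (A i) (xi i)).

(* Main.v *)
(* Call a sublinear functional rough if, at every point, its symmetric second
   differences at scale d are at least a fixed multiple of d.  The Banach space
   is Asplund iff it carries no continuous rough sublinear functional: by Baire,
   a convex function without a dense set of points of Frechet differentiability
   has second differences of order d on a whole ball, and the supremum of its
   subgradients there is rough.

   A rough functional, made coercive by adding a multiple of the norm, gives a
   counterexample to (iii): the normal cones to the exterior of its unit ball
   are all trivial, while the segment from 0 to a point of the unit sphere meets
   that exterior, subtransversally, in a single point.

   Conversely, let the space be Asplund.  Roughness passes from a subspace to
   the whole space, so separable subspaces V have a separable dual, and on such
   a V the norm is uniformly approximated by convex functions that are Frechet
   smooth along V (conjugates of sums of squared dual distances).  A smooth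
   variational principle then yields the fuzzy inclusion relative to V.  Taking
   V closed under countably many witnesses of unsatisfiable finite systems of
   constraints, compactness of the dual ball turns normals relative to V into
   normals in the whole space. *)

Require Import Defs.
From HB Require Import structures.
From mathcomp Require Import all_boot all_order all_algebra.
From mathcomp Require Import all_classical all_reals all_analysis.
From mathcomp Require Import ring lra.
Import Order.TTheory GRing.Theory Num.Theory.
Import numFieldNormedType.Exports.

Set Implicit Arguments.
Unset Strict Implicit.
Unset Printing Implicit Defensive.

Local Open Scope classical_set_scope.
Local Open Scope ring_scope.

(** Second differences take the place of derivatives throughout. For a continuous convex function,
    being $o(\|h\|)$ at a point amounts to Frechet differentiability there; they name no candidate
    derivative, and they can be tested along a subspace only.

    In the passage from Asplund to the fuzzy rule, the functions, their subgradients and the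
    estimate of $p-\sum_i q_i$ live on the whole space; only smoothness and the competing points are
    restricted to [V]. So the single defect of the functionals found on [V] is that normality is
    known only against points of [V].

    The obstacle is circularity: the base points [z] depend on [V], so [V] must be prepared
    beforehand for every base point, radius and tolerance that may occur, using countably many data.
    Hence the rational radii, integer norm bounds, centres taken from a dense sequence, and the
    slack that pays for replacing [z] by such centres. *)

Section Extrema.
Variables (R : realType) (T : Type).
Implicit Types (A : set T) (f : T -> R) (c : R).

Lemma inf_img_le A f c t : (forall u, A u -> c <= f u) -> A t ->
  inf [set f u | u in A] <= f t.
Proof.
move=> h At; apply: ge_inf; last by exists t.
by exists c => _ [u Au <-]; exact: h.
Qed.

Lemma le_inf_img A f c t : A t -> (forall u, A u -> c <= f u) ->
  c <= inf [set f u | u in A].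
Proof.
move=> At h; apply: lb_le_inf; first by exists (f t), t.
by move=> _ [u Au <-]; exact: h.
Qed.

Lemma inf_img_lt A f c t : A t -> inf [set f u | u in A] < c ->
  exists2 u, A u & f u < c.
Proof.
move=> At /inf_lt[]; first by exists (f t), t.
by move=> _ [u Au <-] h; exists u.
Qed.

Lemma sup_img_ge A f c t : (forall u, A u -> f u <= c) -> A t ->
  f t <= sup [set f u | u in A].
Proof.
move=> h At; apply: ub_le_sup; last by exists t.
by exists c => _ [u Au <-]; exact: h.
Qed.

Lemma sup_img_le A f c t : A t -> (forall u, A u -> f u <= c) ->
  sup [set f u | u in A] <= c.
Proof.
move=> At h; apply: ge_sup; first by exists (f t), t.
by move=> _ [u Au <-]; exact: h.
Qed.

Lemma sup_img_gt A f c t : A t -> c < sup [set f u | u in A] ->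
  exists2 u, A u & c < f u.
Proof.
move=> At /sup_gt[]; first by exists (f t), t.
by move=> _ [u Au <-] h; exists u.
Qed.

End Extrema.

(** * Sublinear functionals and the Hahn-Banach theorem *)

Section Sublinear.
Variables (R : realType) (E : lmodType R).
Implicit Types (s p : E -> R) (V : set E).

Definition sublinear s :=
  (forall x y, s (x + y) <= s x + s y) /\
  (forall t x, 0 <= t -> s (t *: x) = t * s x).

Definition is_lin p :=
  (forall x y, p (x + y) = p x + p y) /\ (forall t x, p (t *: x) = t * p x).

Lemma lin0 p : is_lin p -> p 0 = 0.
Proof. by case=> _ h; rewrite -(scale0r (0 : E)) h mul0r. Qed.

Lemma linN p x : is_lin p -> p (- x) = - p x.
Proof. by case=> _ h; rewrite -scaleN1r h mulN1r. Qed.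

Lemma linB p x y : is_lin p -> p (x - y) = p x - p y.
Proof. by move=> h; rewrite (proj1 h) linN. Qed.

Lemma lin_sum p (I : Type) (r : seq I) (F : I -> E) : is_lin p ->
  p (\sum_(i <- r) F i) = \sum_(i <- r) p (F i).
Proof.
move=> h; elim: r => [|i r IH]; first by rewrite !big_nil lin0.
by rewrite !big_cons (proj1 h) IH.
Qed.

Lemma sublinear0 s : sublinear s -> s 0 = 0.
Proof. by case=> _ h; rewrite -(scale0r (0 : E)) h // mul0r. Qed.

Lemma sublinear_ge s x : sublinear s -> - s (- x) <= s x.
Proof.
move=> h; have := proj1 h x (- x); rewrite subrr sublinear0 //; lra.
Qed.

Lemma sublinear_sub s x y : sublinear s -> s x <= s y + s (x - y).
Proof. by move=> h; rewrite -{1}(subrK y x) addrC; exact: (proj1 h). Qed.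

Lemma sublinearP s :
  (forall x y, s (x + y) <= s x + s y) ->
  (forall t x, 0 < t -> s (t *: x) <= t * s x) -> s 0 = 0 -> sublinear s.
Proof.
move=> sD sZ s0; split=> // t x; rewrite le_eqVlt => /predU1P[<-|t0].
  by rewrite scale0r s0 mul0r.
apply/eqP; rewrite eq_le sZ //=.
have := sZ t^-1 (t *: x); rewrite invr_gt0 => /(_ t0).
rewrite scalerA mulVf ?gt_eqF // scale1r => h.
by rewrite -ler_pdivlMl.
Qed.

Lemma is_linP s : sublinear s -> (forall x y, s x + s y <= s (x + y)) ->
  is_lin s.
Proof.
move=> h sD; have sA x y : s (x + y) = s x + s y.
  by apply/eqP; rewrite eq_le sD (proj1 h).
have sN x : s (- x) = - s x.
  by have := sA x (- x); rewrite subrr sublinear0 // => e; lra.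
split=> // t x; have [t0|t0] := leP 0 t; first exact: (proj2 h).
have := proj2 h (- t) x; rewrite scaleNr sN oppr_ge0 (ltW t0) => /(_ isT).
by rewrite mulNr => /oppr_inj.
Qed.

(* The support function of [{p <= s | p x <= b}]. *)
Definition trunc s x (b : R) (y : E) : R :=
  inf [set s (y - t *: x) + t * b | t in [set t | 0 <= t]].

(** The hypothesis on [b] says that [b] is at least [- s (- x)], a lower bound of [p x] for every
    linear [p <= s]. It keeps the infimum bounded below by [- s (- y)]; otherwise [inf] would take
    its default value 0. *)
Lemma trunc_le s x b t y : sublinear s -> 0 <= s (- x) + b -> 0 <= t ->
  trunc s x b y <= s (y - t *: x) + t * b.
Proof.
move=> h sb t0.
apply: (inf_img_le (f := fun t => s (y - t *: x) + t * b) (c := - s (- y))) => //.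
move=> u /= u0; have := proj1 h (- y) (y - u *: x).
rewrite addKr -scalerN (proj2 h) // => e.
have := mulr_ge0 u0 sb; rewrite mulrDr; lra.
Qed.

Lemma trunc_sublinear s x b : sublinear s -> 0 <= s (- x) + b ->
  sublinear (trunc s x b).
Proof.
move=> h sb; apply: sublinearP.
- move=> y z; apply/ler_addgt0Pr => e e0.
  have [t /= t0 te] : exists2 t, 0 <= t & s (y - t *: x) + t * b < trunc s x b y + e / 2.
    by apply: (inf_img_lt (t := 0)) => //=; rewrite ltrDl divr_gt0.
  have [u /= u0 ue] : exists2 u, 0 <= u & s (z - u *: x) + u * b < trunc s x b z + e / 2.
    by apply: (inf_img_lt (t := 0)) => //=; rewrite ltrDl divr_gt0.
  apply: le_trans (trunc_le _ h sb (addr_ge0 t0 u0)) _.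
  have := proj1 h (y - t *: x) (z - u *: x).
  rewrite addrACA -opprD -scalerDl; lra.
- move=> t y t0; rewrite -ler_pdivrMl //.
  apply: (le_inf_img (t := 0)) => //= u u0; rewrite ler_pdivrMl //.
  have tu : 0 <= t * u by rewrite mulr_ge0 // ltW.
  apply: le_trans (trunc_le _ h sb tu) _.
  by rewrite -scalerA -scalerBr (proj2 h) ?(ltW t0) // mulrDr mulrA.
- apply/eqP; rewrite eq_le; apply/andP; split.
    by apply: le_trans (trunc_le _ h sb (lexx 0)) _; rewrite scale0r subr0 mul0r addr0 sublinear0.
  apply: (le_inf_img (t := 0)) => //= u u0.
  by rewrite sub0r -scalerN (proj2 h) // -mulrDr mulr_ge0.
Qed.

Lemma trunc_les s x b y : sublinear s -> 0 <= s (- x) + b ->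
  trunc s x b y <= s y.
Proof.
move=> h sb; apply: le_trans (trunc_le _ h sb (lexx 0)) _.
by rewrite scale0r subr0 mul0r addr0.
Qed.

(** Zorn's lemma for the reversed pointwise order. A chain has its pointwise infimum as bound: this
    is finite because members lie above [- s0 (- x)], and subadditive because, of two members nearly
    optimal at [x] and at [y], the smaller one serves both. The floor [sg] on [V] is what later lets
    roughness pass from [V] to the whole space. *)
Lemma minimal_sublinear s0 V (sg : E -> R) : sublinear s0 ->
  (forall v, V v -> sg v <= s0 v) ->
  exists s, [/\ sublinear s, forall x, s x <= s0 x, forall v, V v -> sg v <= s v &
    forall s', sublinear s' -> (forall x, s' x <= s x) ->
      (forall v, V v -> sg v <= s' v) -> forall x, s' x = s x].
Proof.
move=> h0 V0.
pose good s := [/\ sublinear s, forall x, s x <= s0 x & forall v, V v -> sg v <= s v].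
have g0 : good s0 by split.
pose T := {s : E -> R | good s}.
pose r (a b : T) := `[< forall x, sval b x <= sval a x >].
have [|a b c /asboolP ab /asboolP bc||A Atot|m hm] := @Zorn T r.
- by move=> a; apply/asboolP.
- by apply/asboolP => x; exact: le_trans (bc x) (ab x).
- move=> [a ga] [b gb] /asboolP /= ab /asboolP /= ba.
  by apply: eq_exist; apply/funext => x; apply/eqP; rewrite eq_le ab ba.
- have [[a Aa]|A0] := pselect (A !=set0); last first.
    exists (exist _ s0 g0) => b Ab; exfalso; apply: A0; exists b; exact: Ab.
  pose l x := inf [set sval b x | b in A].
  have lb x (b : T) : A b -> - s0 (- x) <= sval b x.
    move=> _; have [hb bs _] := svalP b.
    by apply: le_trans (sublinear_ge x hb); rewrite lerN2.
  have lle x (b : T) : A b -> l x <= sval b x.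
    by move=> Ab; apply: (inf_img_le (f := fun b : T => sval b x) (c := - s0 (- x))) => // ?; exact: lb.
  have lsub : sublinear l.
    apply: sublinearP.
    + move=> x y; apply/ler_addgt0Pr => e e0.
      have [b /= Ab be] : exists2 b, A b & sval b x < l x + e / 2.
        by apply: (inf_img_lt (t := a)) => //; rewrite ltrDl divr_gt0.
      have [c /= Ac ce] : exists2 b, A b & sval b y < l y + e / 2.
        by apply: (inf_img_lt (t := a)) => //; rewrite ltrDl divr_gt0.
      have [hb _ _] := svalP b; have [hc _ _] := svalP c.
      have [/asboolP bc|/asboolP cb] := Atot _ _ Ab Ac.
        have := lle (x + y) c Ac; have := proj1 hc x y; have := bc x; lra.
      have := lle (x + y) b Ab; have := proj1 hb x y; have := cb y; lra.
    + move=> t x t0; rewrite -ler_pdivrMl //.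
      apply: (le_inf_img (t := a)) => //= b Ab; rewrite ler_pdivrMl //.
      by apply: le_trans (lle _ b Ab) _; have [hb _ _] := svalP b; rewrite (proj2 hb) // ltW.
    + apply/eqP; rewrite eq_le; apply/andP; split.
        by apply: le_trans (lle _ a Aa) _; have [hb _ _] := svalP a; rewrite sublinear0.
      by apply: (le_inf_img (t := a)) => //= b Ab; have [hb _ _] := svalP b; rewrite sublinear0.
  have gl : good l.
    split=> //.
      by move=> x; apply: le_trans (lle _ a Aa) _; have [_ ->] := svalP a.
    move=> v Vv; apply: (le_inf_img (t := a)) => //= b Ab.
    by have [_ _ ->] := svalP b.
  by exists (exist _ l gl) => b Ab; apply/asboolP => x /=; exact: lle.
- have [sm ms mV] := svalP m; exists (sval m); split=> // s' hs' s'm s'V x.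
  have gs' : good s' by split=> // y; apply: le_trans (s'm y) (ms y).
  by rewrite -(hm (exist _ s' gs')) //; apply/asboolP.
Qed.

(* Minimal sublinear functionals are linear. *)
Lemma hahn_banach s0 : sublinear s0 ->
  exists2 p, is_lin p & forall x, p x <= s0 x.
Proof.
move=> h0; have [||s [hs ss0 _ smin]] := @minimal_sublinear s0 set0 (fun=> 0) => //.
exists s => //; apply: is_linP => // x y.
(* Truncation in the direction [- y] at the extreme level [- s y] cannot lower the minimal [s]; the
   term [t = 1] of its infimum then says [s x <= s (x + y) - s y]. *)
have sb : 0 <= s (- (- y)) + - s y by rewrite opprK subrr.
have <- := smin _ (trunc_sublinear hs sb) (fun z => trunc_les z hs sb) _ x => //.
have := trunc_le (t := 1) x hs sb ler01; rewrite scale1r opprK mul1r; lra.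
Qed.

End Sublinear.

(** * Convex functions, second differences and subgradients *)

Section Convex.
Variables (R : realType) (E : lmodType R).
Implicit Types (f : E -> R).

Definition is_subspace (V : set E) := [/\ V 0, forall x y, V x -> V y -> V (x + y) &
  forall t x, V x -> V (t *: x)].

Definition second_diff f x h := f (x + h) + f (x - h) - 2 * f x.

Definition cvx f := forall t x y, 0 <= t -> t <= 1 ->
  f (t *: x + (1 - t) *: y) <= t * f x + (1 - t) * f y.

Lemma half_double (x : E) : 2^-1 *: (x + x) = x.
Proof. by rewrite scalerDr -scalerDl -[2^-1]mul1r -splitr scale1r. Qed.

Lemma sublinear_cvx f : sublinear f -> cvx f.
Proof.
move=> h t x y t0 t1; apply: le_trans (proj1 h _ _) _.
by rewrite !(proj2 h) // subr_ge0.
Qed.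

Lemma cvx_mid f x y : cvx f -> 2 * f (2^-1 *: (x + y)) <= f x + f y.
Proof.
move=> h; have := @h 2^-1 x y; rewrite scalerDr.
have -> : 1 - 2^-1 = 2^-1 :> R by lra.
move=> /(_ _ _); lra.
Qed.

Lemma cvx_slope f x h t : cvx f -> 0 < t -> t <= 1 ->
  f (x + t *: h) - f x <= t * (f (x + h) - f x).
Proof.
move=> cf t0 t1; have := cf t (x + h) x (ltW t0) t1.
rewrite scalerDr addrAC -scalerDl subrKC scale1r; lra.
Qed.

Lemma cvx_second_scale f x h t : cvx f -> 0 < t -> t <= 1 ->
  second_diff f x (t *: h) <= t * second_diff f x h.
Proof.
rewrite /second_diff => cf t0 t1; have := cvx_slope x h cf t0 t1.
have := cvx_slope x (- h) cf t0 t1; rewrite scalerN; lra.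
Qed.

(** Hahn-Banach applied to the one-sided directional derivative, which is the infimum of the
    difference quotients because these increase with [t]. The resulting [p] is linear in the
    algebraic sense; bounds on it are derived later from local bounds on [f]. *)
Lemma subgradient f x : cvx f ->
  exists2 p, is_lin p & forall h, f x + p h <= f (x + h).
Proof.
move=> cf.
pose q t h := (f (x + t *: h) - f x) / t.
pose s h := inf [set q t h | t in [set t | 0 < t]].
(* [x] is the combination of [x + t *: h] and [x - h] with weights [1 / (1 + t)] and
   [t / (1 + t)]. *)
have lb h t : 0 < t -> f x - f (x - h) <= q t h.
  move=> t0; rewrite /q ler_pdivlMr //.
  have u0 : 0 < 1 + t by lra.
  have := cf ((1 + t)^-1) (x + t *: h) (x - h).
  rewrite invr_ge0 (ltW u0) invf_le1 // lerDl (ltW t0) => /(_ isT isT).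
  have e : 1 - (1 + t)^-1 = (1 + t)^-1 * t.
    by field; rewrite gt_eqF.
  have -> : (1 + t)^-1 *: (x + t *: h) + (1 - (1 + t)^-1) *: (x - h) = x.
    rewrite e !scalerDr !scalerA addrACA -scalerDl scalerN subrr addr0.
    have -> : (1 + t)^-1 + (1 + t)^-1 * t = 1 by field; rewrite gt_eqF.
    by rewrite scale1r.
  rewrite e => hh.
  have : (1 + t) * f x <= f (x + t *: h) + t * f (x - h).
    rewrite mulrC -ler_pdivlMr //; apply: le_trans hh _.
    by rewrite mulrDl; lra.
  lra.
have sle h t : 0 < t -> s h <= q t h.
  by move=> t0; apply: (inf_img_le (f := fun t => q t h) (c := f x - f (x - h))) => // u; exact: lb.
have qmon h t u : 0 < t -> t <= u -> q t h <= q u h.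
  move=> t0 tu; have u0 := lt_le_trans t0 tu.
  rewrite /q ler_pdivrMr //.
  have := @cvx_slope f x (u *: h) (t / u) cf.
  rewrite divr_gt0 // => /(_ isT); rewrite ler_pdivrMr // mul1r => /(_ tu).
  rewrite scalerA divfK ?gt_eqF //; move/le_trans; apply.
  by rewrite le_eqVlt; apply/orP; left; apply/eqP; field; rewrite gt_eqF.
have hs : sublinear s.
  apply: sublinearP.
  - move=> h k; apply/ler_addgt0Pr => e e0.
    have [t /= t0 te] : exists2 t, 0 < t & q t h < s h + e / 2.
      by apply: (inf_img_lt (t := 1)) => //=; rewrite ltrDl divr_gt0.
    have [u /= u0 ue] : exists2 u, 0 < u & q u k < s k + e / 2.
      by apply: (inf_img_lt (t := 1)) => //=; rewrite ltrDl divr_gt0.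
    (* Half of a common step: the midpoint of [x + (w * 2) *: h] and [x + (w * 2) *: k] is
       [x + w *: (h + k)]. *)
    pose w := Num.min t u / 2.
    have m0 : 0 < Num.min t u by rewrite lt_min t0 u0.
    have w0 : 0 < w by rewrite divr_gt0.
    have wt : w * 2 <= t by rewrite divfK ?gt_eqF // ge_min lexx.
    have wu : w * 2 <= u by rewrite divfK ?gt_eqF // ge_min lexx orbT.
    apply: le_trans (sle (h + k) w w0) _.
    have := qmon h _ _ _ wt; have := qmon k _ _ _ wu; rewrite mulr_gt0 // => /(_ isT) a /(_ isT) b.
    suff : q w (h + k) <= q (w * 2) h + q (w * 2) k by lra.
    rewrite /q -mulrDl ler_pdivrMr //.
    have := cvx_mid (x + (w * 2) *: h) (x + (w * 2) *: k) cf.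
    have -> : 2^-1 *: (x + (w * 2) *: h + (x + (w * 2) *: k)) = x + w *: (h + k).
      by rewrite addrACA scalerDr half_double -scalerDr scalerA mulrCA mulVf ?pnatr_eq0 // mulr1.
    rewrite /q => hh.
    have -> : (f (x + (w * 2) *: h) - f x + (f (x + (w * 2) *: k) - f x)) / (w * 2) * w
      = (f (x + (w * 2) *: h) - f x + (f (x + (w * 2) *: k) - f x)) / 2.
      by field; rewrite gt_eqF.
    by rewrite ler_pdivlMr //; lra.
  - move=> t h t0; rewrite -ler_pdivrMl //.
    apply: (le_inf_img (t := 1)) => //= u u0; rewrite ler_pdivrMl //.
    apply: le_trans (sle _ (u / t) (divr_gt0 u0 t0)) _.
    rewrite /q scalerA divfK ?gt_eqF // invf_div.
    by rewrite le_eqVlt; apply/orP; left; apply/eqP; ring.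
  - have q0 t : q t 0 = 0 by rewrite /q scaler0 addr0 subrr mul0r.
    apply/eqP; rewrite eq_le; apply/andP; split.
      by apply: le_trans (sle 0 1 ltr01) _; rewrite q0.
    by apply: (le_inf_img (t := 1)) => //= t _; rewrite q0.
have [p lp ps] := hahn_banach hs; exists p => // h.
have := le_trans (ps h) (sle h 1 ltr01); rewrite /q scale1r divr1; lra.
Qed.

End Convex.

(** * Rough functionals *)

Section Rough.
Variables (R : realType) (X : normedModType R).
Implicit Types (s p f : X -> R) (V : set X) (C : set (X -> R)) (e L : R).

Definition bounded_lin L p := is_lin p /\ forall x, p x <= L * `|x|.

Lemma bounded_lin_norm L p x : bounded_lin L p -> `|p x| <= L * `|x|.
Proof.
case=> lp pL; rewrite ler_norml pL andbT lerNl -linN //.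
by rewrite -[`|x|]normrN.
Qed.

Definition rough V e s := forall x d, V x -> 0 < d ->
  exists h, [/\ V h, `|h| <= d & e * d <= second_diff s x h].

Definition has_rough := exists s L e, [/\ 0 < e, sublinear s,
  forall x, s x <= L * `|x| & rough setT e s].

Lemma sup_lin_sublinear C L p0 : C p0 -> (forall p, C p -> bounded_lin L p) ->
  sublinear (fun x => sup [set p x | p in C]).
Proof.
move=> Cp0 CL.
have ub x p : C p -> p x <= L * `|x| by move=> /CL[].
apply: sublinearP.
- move=> x y; apply: (sup_img_le (t := p0) (f := fun p => p (x + y))) => // p Cp.
  rewrite (proj1 (proj1 (CL _ Cp))).
  by apply: lerD; [apply: (sup_img_ge (f := fun p => p x) (c := L * `|x|))|
    apply: (sup_img_ge (f := fun p => p y) (c := L * `|y|))] => // q; exact: ub.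
- move=> t x t0; apply: (sup_img_le (t := p0) (f := fun p => p (t *: x))) => // p Cp.
  rewrite (proj2 (proj1 (CL _ Cp))) ler_pM2l //.
  by apply: (sup_img_ge (f := fun p => p x) (c := L * `|x|)) => // q; exact: ub.
- apply/eqP; rewrite eq_le; apply/andP; split.
    apply: (sup_img_le (t := p0) (f := fun p => p 0)) => // p Cp.
    by rewrite lin0 //; case: (CL _ Cp).
  rewrite -(lin0 (proj1 (CL _ Cp0))).
  apply: (sup_img_ge (f := fun p => p 0) (c := L * `|0 : X|)) => // q; exact: ub.
Qed.

(** [C] has no small slices: near-maximisers [p] and [q] at [x] can differ by [e] in a direction
    [h]. Testing [p] at [x + d *: h] and [q] at [x - d *: h] makes the second difference at least
    [e * d] minus twice the slack; the slack [e * d / 8] leaves more than half. *)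
Lemma nondentable_rough V C L e p0 : C p0 ->
  (forall p, C p -> bounded_lin L p) -> 0 < e ->
  (forall h t, V h -> 0 < t -> V (t *: h)) ->
  (forall x a, V x -> 0 < a -> exists p q h,
    [/\ C p, sup [set r x | r in C] - a < p x,
        C q, sup [set r x | r in C] - a < q x &
        [/\ V h, `|h| <= 1 & e <= p h - q h]]) ->
  rough V (e / 2) (fun x => sup [set p x | p in C]).
Proof.
move=> Cp0 CL e0 VZ; pose S x := sup [set p x | p in C].
rewrite -/S => H x d Vx d0.
have [|p [q [h [Cp px Cq qx [Vh h1 ph]]]]] := H x (e * d / 8) Vx.
  by rewrite divr_gt0 // mulr_gt0.
exists (d *: h); split; first exact: VZ.
  by rewrite normrZ gtr0_norm // ler_piMr // ltW.
have ub y r : C r -> r y <= S y.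
  move=> Cr; apply: (sup_img_ge (f := fun p => p y) (c := L * `|y|)) => // u.
  by move=> /CL[].
have [lp _] := CL _ Cp; have [lq _] := CL _ Cq.
have := ub (x + d *: h) _ Cp; have := ub (x - d *: h) _ Cq.
rewrite /second_diff (proj1 lp) (linB _ _ lq) (proj2 lp) (proj2 lq).
have : d * e <= d * (p h - q h) by rewrite ler_pM2l.
by move: px qx (mulr_gt0 e0 d0); rewrite -!/(S _); lra.
Qed.

(* A minimal sublinear functional agreeing with [sg] on [V] is rough on the
   whole space, because its truncation in the direction [x] must fail to
   dominate [sg] somewhere on [V]. *)
Lemma rough_extend V e sg L : 0 < e -> is_subspace V ->
  sublinear sg -> (forall x, sg x <= L * `|x|) -> rough V e sg -> has_rough.
Proof.
move=> e0 [V0 VD VZ] hsg sgL rsg.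
have [|s [hs ssg sV smin]] := @minimal_sublinear R X sg V sg hsg => //.
exists s, L, (e / 2); split; first by rewrite divr_gt0.
- by [].
- by move=> x; apply: le_trans (ssg x) (sgL x).
move=> x d _ d0.
(* Truncating at a level below [s x] strictly lowers [s] at [x], so by minimality the floor [sg]
   must be violated at some [v]. Roughness of [sg] at this [v], at scale [t * d], is then divided by
   [t]; the deficit [e * d / 4], counted twice, halves the constant. *)
pose b := s x - e * d / 4.
have ed : 0 < e * d / 4 by rewrite divr_gt0 // mulr_gt0.
have [v [t [Vv t0 vt]]] : exists v t, [/\ V v, 0 <= t & s (v - t *: x) + t * b < sg v].
  apply: contrapT => N.
  have NN v t : V v -> 0 <= t -> sg v <= s (v - t *: x) + t * b.
    by move=> Vv t0; rewrite leNgt; apply/negP => ?; apply: N; exists v, t.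
  have sb : 0 <= s (- x) + b.
    by have := NN 0 1 V0 ler01; rewrite sub0r scale1r mul1r sublinear0.
  have := smin _ (trunc_sublinear hs sb) (fun z => trunc_les z hs sb).
  have tV v : V v -> sg v <= trunc s x b v.
    by move=> Vv; apply: (le_inf_img (t := 0)) => //= t t0; exact: NN.
  move=> /(_ tV x) E; have := trunc_le (t := 1) x hs sb ler01.
  rewrite E scale1r subrr sublinear0 // mul1r add0r /b; lra.
have {}t0 : 0 < t.
  rewrite lt_neqAle t0 andbT; apply/negP => /eqP E; move: vt.
  by rewrite -E scale0r subr0 mul0r addr0 ltNge sV.
have [h [Vh hd hh]] := rsg v (t * d) Vv (mulr_gt0 t0 d0).
exists (t^-1 *: h); split=> //.
  by rewrite normrZ gtr0_norm ?invr_gt0 // ler_pdivrMl.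
have e1 (k : X) : V k -> sg (v + k) <= s (v - t *: x) + t * s (x + t^-1 *: k).
  move=> Vk; apply: le_trans (sV _ (VD _ _ Vv Vk)) _.
  rewrite -(proj2 hs) ?(ltW t0) // scalerDr scalerA mulfV ?gt_eqF // scale1r.
  by apply: le_trans (proj1 hs _ _); rewrite addrA subrK.
have A := e1 h Vh.
have B : sg (v - h) <= s (v - t *: x) + t * s (x - t^-1 *: h).
  by have := e1 (- h); rewrite scalerN; apply; rewrite -scaleN1r; exact: VZ.
move: hh vt; rewrite /second_diff /b => hh vt.
rewrite -(ler_pM2l t0).
have : t * (e * d / 4) = e * (t * d) / 4 by ring.
lra.
Qed.

End Rough.

(** * Roughness and Frechet differentiability *)

Section ConvexDiff.
Variables (R : realType) (X : normedModType R).
Implicit Types (f : X -> R) (L : R).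

Lemma convex_functionE f :
  @convex_function R X [set: X] (f : X -> R^o) <-> cvx f.
Proof.
split=> [h t x y t0 t1|h t x y _ _].
  have := h (Itv01 t0 t1) x y; rewrite !inE => /(_ I I); exact.
exact: (h t%:num x y).
Qed.

Lemma nbhs_dist (x : X) (P : X -> Prop) :
  (\forall y \near x, P y) <-> exists2 d, 0 < d & forall y, `|x - y| < d -> P y.
Proof.
split=> [/nbhs_ballP[d /= d0 h]|[d d0 h]].
  by exists d => // y xy; apply: h; rewrite -ball_normE.
by apply/nbhs_ballP; exists d => //= y; rewrite -ball_normE; exact: h.
Qed.

Lemma continuous_dist f : (forall x e, 0 < e -> exists2 d, 0 < d &
  forall y, `|x - y| < d -> `|f x - f y| <= e) -> continuous (f : X -> R^o).
Proof.
move=> h x; apply/cvgrPdist_le => e e0; apply/nbhs_dist; exact: h.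
Qed.

Lemma lipschitz_continuous f L : (forall x y, `|f x - f y| <= L * `|x - y|) ->
  continuous (f : X -> R^o).
Proof.
move=> h; apply: continuous_dist => x e e0.
exists (e / (`|L| + 1)) => [|y xy]; first by rewrite divr_gt0 // ltr_wpDl.
apply: le_trans (h x y) _.
apply: le_trans (ler_wpM2r _ (ler_norm L)) _ => //.
have : `|x - y| * (`|L| + 1) <= e.
  by rewrite -ler_pdivlMr ?ltr_wpDl //; exact: ltW.
have := normr_ge0 (x - y); lra.
Qed.

Lemma sublinear_lipschitz s L x y : sublinear s -> (forall x : X, s x <= L * `|x|) ->
  `|s x - s y| <= L * `|x - y| :> R.
Proof.
move=> hs sL; rewrite ler_norml; apply/andP; split.
  have := sublinear_sub y x hs; have := sL (y - x); rewrite distrC; lra.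
have := sublinear_sub x y hs; have := sL (x - y); lra.
Qed.

Lemma differentiable_dist f x : differentiable (f : X -> R^o) x ->
  exists2 p : X -> R, is_lin p & forall e, 0 < e -> exists2 d, 0 < d &
    forall h, `|h| < d -> `|f (x + h) - f x - p h| <= e * `|h|.
Proof.
move=> /diff_locallyP[_ /eqaddoP E].
exists ('d (f : X -> R^o) x).
  by split=> *; rewrite ?linearD ?linearZ.
move=> e e0; have /nbhs_dist[d d0 hd] := E e e0.
exists d => // h hh; have := hd h; rewrite sub0r normrN => /(_ hh) /=.
by rewrite /cst !fctE /= opprD addrA (addrC h).
Qed.

Lemma dist_differentiable f L x (p : X -> R) : bounded_lin L p ->
  (forall e, 0 < e -> exists2 d, 0 < d &
    forall h, `|h| < d -> `|f (x + h) - f x - p h| <= e * `|h|) ->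
  differentiable (f : X -> R^o) x.
Proof.
move=> bp H.
have pc : continuous (p : X -> R^o).
  apply: (@lipschitz_continuous p L) => u v.
  by rewrite -(linB _ _ (proj1 bp)); exact: bounded_lin_norm.
have pl : linear (p : X -> R^o).
  by move=> a u v; rewrite (proj1 (proj1 bp)) (proj2 (proj1 bp)).
pose P : {linear X -> R^o} := HB.pack (p : X -> R^o)
  (GRing.isLinear.Build R X R^o *:%R (p : X -> R^o) pl).
have E : (f : X -> R^o) \o shift x = cst (f x) + (P : X -> R^o) +o_ 0 id.
  apply/eqaddoP => e e0; apply/nbhs_dist.
  have [d d0 hd] := H e e0; exists d => // h; rewrite sub0r normrN => hh.
  have := hd h hh; by rewrite /cst !fctE /= opprD addrA (addrC h).
by apply/diff_locallyP; rewrite (diff_unique _ E).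
Qed.

Lemma second_diff_small f x : differentiable (f : X -> R^o) x ->
  forall e, 0 < e -> exists2 d, 0 < d & forall h, `|h| < d ->
    second_diff f x h <= e * `|h|.
Proof.
move=> /differentiable_dist[p lp H] e e0; have [|d d0 hd] := H (e / 2).
  by rewrite divr_gt0.
exists d => // h hh; have := hd h hh; have := hd (- h).
rewrite normrN (linN _ lp) => /(_ hh); rewrite !ler_norml /second_diff.
by move=> /andP[_ A] /andP[_ B]; lra.
Qed.

End ConvexDiff.

Lemma rough_not_asplund (R : realType) (X : completeNormedModType R) :
  has_rough X -> ~ asplund X.
Proof.
move=> [s [L [e [e0 hs sL rs]]]] /(_ s) [||D dD hD].
- by apply: (@lipschitz_continuous _ _ _ L) => x y; exact: sublinear_lipschitz.
- by apply/convex_functionE; exact: sublinear_cvx.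
have [|x [_ Dx]] := dD setT _ (@openT X); first by exists 0.
have [|d d0 hd] := second_diff_small (hD _ Dx) (e := e / 2).
  by rewrite divr_gt0.
have d20 : 0 < d / 2 by rewrite divr_gt0.
have [h [_ h1 h2]] := rs x (d / 2) I d20.
have hhd : `|h| < d by lra.
have := hd h hhd; have : e / 2 * `|h| <= e / 2 * (d / 2).
  by rewrite ler_pM2l // divr_gt0.
have := mulr_gt0 e0 d0; lra.
Qed.

(** * From roughness on a ball to a rough sublinear functional *)

Section LocalLipschitz.
Variables (R : realType) (X : normedModType R).
Implicit Types (f : X -> R).

Lemma cvx_locally_lipschitz f x0 r K : cvx f -> 0 < r -> 0 <= K ->
  (forall y, `|x0 - y| < 2 * r -> `|f y| <= K) ->
  forall x y, `|x0 - x| < r -> `|x0 - y| < r ->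
    `|f x - f y| <= (4 * K / r) * `|x - y|.
Proof.
move=> cf r0 K0 bf.
suff W x y : `|x0 - x| < r -> `|x0 - y| < r -> f y - f x <= (4 * K / r) * `|x - y|.
  move=> x y hx hy; rewrite ler_norml; have := W _ _ hx hy.
  have := W _ _ hy hx; rewrite (distrC y) => A B; apply/andP; split; lra.
move=> hx hy.
have [->|xy] := eqVneq x y; first by rewrite !subrr normr0 mulr0.
set n := `|x - y|; have n0 : 0 < n by rewrite normr_gt0 subr_eq0.
pose t := n / (n + r * 2^-1); have nr : 0 < n + r * 2^-1 by rewrite addr_gt0 // divr_gt0.
(* [y] lies between [x] and a point [z] at distance [r / 2] beyond [y] *)
pose z := y + (r * 2^-1 / n) *: (y - x).
have hz : `|x0 - z| < 2 * r.
  rewrite /z opprD addrA; apply: le_lt_trans (ler_normB _ _) _.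
  have rn : 0 < r * 2^-1 / n by rewrite !divr_gt0.
  rewrite normrZ (gtr0_norm rn) (distrC y x) -/n divfK ?gt_eqF //; lra.
have t0 : 0 <= t by rewrite divr_ge0 // ltW.
have t1 : t <= 1 by rewrite ler_pdivrMr // mul1r; lra.
have := cf t z x t0 t1.
have -> : t *: z + (1 - t) *: x = y.
  have e1 : t * (r * 2^-1 / n) = 1 - t.
    by rewrite /t; field; rewrite !gt_eqF //; lra.
  rewrite /z scalerDr scalerA e1 -addrA -scalerDr subrK -scalerDl subrKC.
  exact: scale1r.
have := bf z hz; have := bf x; rewrite !ler_norml => /(_ _) /andP[|A B]; first lra.
move=> /andP[C D].
have tn : t <= n * (2 / r).
  rewrite /t ler_pM2l // -[2 / r]invf_div lef_pV2 ?posrE ?divr_gt0 //; lra.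
have : t * (2 * K) <= n * (2 / r) * (2 * K).
  by rewrite ler_wpM2r // mulr_ge0.
have -> : 4 * K / r * n = n * (2 / r) * (2 * K) by field; rewrite gt_eqF.
have : t * (f z - f x) <= t * (2 * K) by rewrite ler_wpM2l //; lra.
lra.
Qed.

End LocalLipschitz.

Section RoughRegion.
Variables (R : realType) (X : normedModType R).
Implicit Types (f p : X -> R) (e L : R).

Lemma lin_bounded_near p L d : is_lin p -> 0 < d ->
  (forall h, `|h| < d -> p h <= L * `|h|) -> bounded_lin L p.
Proof.
move=> lp d0 H; split=> // x.
pose t := d / (2 * (`|x| + 1)).
have n0 : 0 < `|x| + 1 by rewrite ltr_wpDl.
have t0 : 0 < t by rewrite divr_gt0 // mulr_gt0.
have := H (t *: x); rewrite normrZ gtr0_norm // (proj2 lp) mulrCA ler_pM2l //.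
apply; have : t * (2 * (`|x| + 1)) = d by rewrite divfK // gt_eqF // mulr_gt0.
by have := mulr_ge0 (ltW t0) (normr_ge0 x); lra.
Qed.

Lemma lin_bounded_ball p c : is_lin p -> 0 < c ->
  (forall h, `|h| < c -> p h <= 1) -> bounded_lin (2 / c) p.
Proof.
move=> lp c0 H; split=> // h.
have [->|h0] := eqVneq h 0; first by rewrite lin0 // normr0 mulr0.
have n0 : 0 < `|h| by rewrite normr_gt0.
have := H ((c / 2 / `|h|) *: h); rewrite (proj2 lp) normrZ gtr0_norm ?divr_gt0 //.
rewrite divfK ?gt_eqF // gtr_pMr // invf_lt1 // ltr1n => /(_ isT).
rewrite -ler_pdivlMl ?divr_gt0 // mulr1.
suff -> : (c / 2 / `|h|)^-1 = 2 / c * `|h| by [].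
by field; rewrite !gt_eqF.
Qed.

(** By convexity a bound at one scale controls all smaller scales, so a single scale is enough to
    certify near-smoothness at a point. *)
Lemma second_diff_shrink f x d e c : cvx f -> 0 < c -> c <= d ->
  (forall h, `|h| <= d -> second_diff f x h <= e * d) ->
  forall h, `|h| <= c -> second_diff f x h <= e * c.
Proof.
move=> cf c0 cd H h hc; have d0 := lt_le_trans c0 cd.
have e1 : h = (c / d) *: ((d / c) *: h).
  by rewrite scalerA (_ : _ * _ = 1) ?scale1r //; field; rewrite !gt_eqF.
rewrite e1; apply: le_trans (cvx_second_scale _ _ cf _ _) _.
- by rewrite divr_gt0.
- by rewrite ler_pdivrMr // mul1r.
have -> : e * c = (c / d) * (e * d) by field; rewrite gt_eqF.
rewrite ler_pM2l ?divr_gt0 //; apply: H.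
rewrite normrZ gtr0_norm ?divr_gt0 //.
by rewrite -mulrA ler_piMr ?(ltW d0) // ler_pdivrMl // mulr1.
Qed.

(** [C] gathers the subgradients at points of the ball, and its slices are shown to be wide. Take
    [p] at [u] almost maximal in the direction [x]. Moving to [u + t *: x] loses little in that
    direction, since subgradients are monotone, and the large second difference there separates the
    subgradients at the two ends [u + t *: x + h0] and [u + t *: x - h0]. *)
Lemma rough_region_has_rough f x0 r L e : cvx f -> 0 < r -> 0 <= L -> 0 < e ->
  (forall x y, `|x0 - x| < r -> `|x0 - y| < r -> `|f x - f y| <= L * `|x - y|) ->
  (forall x d, `|x0 - x| < r -> 0 < d -> exists2 h, `|h| <= d &
    e * d <= second_diff f x h) -> has_rough X.
Proof.
move=> cf r0 L0 e0 fL fr.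
pose C := [set p : X -> R | is_lin p /\ exists2 u, `|x0 - u| < r &
  forall h, f u + p h <= f (u + h)].
have CL p : C p -> bounded_lin L p.
  move=> [lp [u ur up]]; apply: (@lin_bounded_near p L (r - `|x0 - u|)) => //.
    by rewrite subr_gt0.
  move=> h hh; have uh : `|x0 - (u + h)| < r.
    by rewrite opprD addrA; apply: le_lt_trans (ler_normB _ _) _; lra.
  have := up h; have := fL _ _ uh ur; rewrite addrAC subrr add0r ler_norml.
  by move=> /andP[_]; lra.
have [p0 lp0 p0h] := subgradient x0 cf.
have Cp0 : C p0 by split=> //; exists x0 => //; rewrite subrr normr0.
exists (fun x => sup [set p x | p in C]), L, (e / 2); split.
- by rewrite divr_gt0.
- exact: sup_lin_sublinear Cp0 CL.
- move=> x; apply: (sup_img_le (t := p0) (f := fun p => p x)) => // p /CL[_]; exact.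
apply: (nondentable_rough Cp0 CL) => // x a _ a0.
have [p Cp px] : exists2 p, C p & sup [set p x | p in C] - a / 2 < p x.
  by apply: (sup_img_gt (t := p0) (f := fun p => p x)) => //; rewrite ltrBlDr ltrDl divr_gt0.
have [lp [u ur up]] := Cp.
pose rho := r - `|x0 - u|; have rho0 : 0 < rho by rewrite subr_gt0.
have nx0 : 0 < `|x| + 1 by rewrite ltr_wpDl.
pose t := rho / (2 * (`|x| + 1)).
have t0 : 0 < t by rewrite divr_gt0 // mulr_gt0.
have tx : t * `|x| <= rho / 2.
  have : t * (2 * (`|x| + 1)) = rho by rewrite divfK // gt_eqF // mulr_gt0.
  by lra.
have L10 : 0 < L + 1 by rewrite ltr_wpDl.
(* The first bound keeps every point inside the ball; the second makes the error [2 * L * d] caused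
   by the displacement at most [t * a / 2]. *)
pose d := Num.min (rho / 4) (t * a / (4 * (L + 1))).
have d0 : 0 < d by rewrite lt_min !divr_gt0 // !mulr_gt0.
have d1 : d <= rho / 4 by rewrite ge_min lexx.
have d2 : d * (4 * (L + 1)) <= t * a.
  by rewrite -ler_pdivlMr ?mulr_gt0 // ge_min lexx orbT.
have near (k : X) : `|k| <= d -> `|x0 - (u + t *: x + k)| < r.
  move=> kd; rewrite !opprD !addrA; apply: le_lt_trans (ler_normB _ _) _.
  have := ler_normB (x0 - u) (t *: x); rewrite normrZ gtr0_norm //.
  rewrite /rho in tx d1 rho0; lra.
have [h0 h0d h0e] : exists2 h, `|h| <= d & e * d <= second_diff f (u + t *: x) h.
  by apply: fr => //; have := near 0; rewrite addr0 normr0; apply; exact: ltW.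
have slice k q : `|k| <= d -> is_lin q -> (forall h, f (u + t *: x + k) + q h <= f (u + t *: x + k + h)) ->
    C q /\ sup [set r x | r in C] - a < q x.
  move=> kd lq qh; have Cq : C q by split=> //; exists (u + t *: x + k) => //; exact: near.
  split=> //.
  have := up (t *: x + k); rewrite addrA (proj1 lp) (proj2 lp).
  have := qh (- (t *: x + k)); have -> : u + t *: x + k - (t *: x + k) = u by rewrite -(addrA u) addrK.
  rewrite (linN _ lq) (proj1 lq) (proj2 lq).
  have := bounded_lin_norm k (CL _ Cp); have := bounded_lin_norm k (CL _ Cq).
  rewrite !ler_norml => /andP[A1 A2] /andP[B1 B2] E1 E2.
  have kL : L * `|k| <= L * d by rewrite ler_wpM2l.
  have : t * (p x - a / 2) <= t * q x.
    have : L * d * 4 <= t * a by lra.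
    lra.
  rewrite ler_pM2l //; lra.
have [p1 lp1 p1h] := subgradient (u + t *: x + h0) cf.
have [p2 lp2 p2h] := subgradient (u + t *: x - h0) cf.
have [C1 s1] := slice _ _ h0d lp1 p1h.
have [|C2 s2] := slice (- h0) _ _ lp2 p2h; first by rewrite normrN.
exists p1, p2, (d^-1 *: h0); split=> //; split=> //.
  by rewrite normrZ gtr0_norm ?invr_gt0 // ler_pdivrMl // mulr1.
rewrite (proj2 lp1) (proj2 lp2) -mulrBr ler_pdivlMl // mulrC.
have := p1h (- h0); have := p2h h0; rewrite addrK subrK (linN _ lp1).
by move: h0e; rewrite /second_diff; lra.
Qed.

End RoughRegion.

(** * Baire category: without rough functionals, differentiability is generic *)

Section Baire.
Variables (R : realType) (X : completeNormedModType R).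

(** A point lying in every [S n] is a point of differentiability: one good scale for each [n] gives
    all smaller ones, and any subgradient is then the derivative. Baire's theorem is applied to the
    interiors; an open set missing one of these interiors is a region of roughness. *)
Lemma dense_differentiable (f : X -> R) : ~ has_rough X ->
  continuous (f : X -> R^o) -> cvx f ->
  dense [set x | differentiable (f : X -> R^o) x].
Proof.
move=> NR cf vf.
pose S n := [set x : X | exists2 d, 0 < d &
  forall h, `|h| <= d -> second_diff f x h <= n.+1%:R^-1 * d].
have fc (x : X) (e : R) : 0 < e -> exists2 d, 0 < d & forall y, `|x - y| < d -> `|f x - f y| <= e.
  move=> e0; have /cvgrPdist_le /(_ e e0) := cf x.
  by move/nbhs_dist.
have Sdiff x : (forall n, S n x) -> differentiable (f : X -> R^o) x.
  move=> Sx; have [p lp ph] := subgradient x vf.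
  have [c c0 hc] := fc x 1 ltr01.
  have bp : bounded_lin (2 / c) p.
    apply: lin_bounded_ball => // h hh; have := ph h; have := hc (x + h).
    rewrite opprD addrA subrr sub0r normrN ler_norml => /(_ hh)/andP[]; lra.
  apply: (dist_differentiable bp) => e e0.
  have [n ne] : exists n : nat, n.+1%:R^-1 <= e.
    have [n hn] := ltr_add_invr e0; exists n; move: hn; rewrite add0r; exact: ltW.
  have [d d0 hd] := Sx n; move: (n.+1%:R^-1) ne hd => k ne hd.
  exists d => // h hh.
  have [->|h0] := eqVneq h 0; first by rewrite addr0 lin0 // !subr0 subrr !normr0 mulr0.
  have n0 : 0 < `|h| by rewrite normr_gt0.
  have := second_diff_shrink vf n0 (ltW hh) hd (lexx _).
  have := ph h; have := ph (- h); rewrite (linN _ lp) /second_diff.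
  have : k * `|h| <= e * `|h| by rewrite ler_pM2r.
  by move=> A B C D; rewrite ger0_norm; lra.
suff dU n : open (interior (S n)) /\ dense (interior (S n)).
  move=> W W0 Wo; have [x [Wx Ux]] := Baire dU W0 Wo.
  exists x; split=> //; apply: Sdiff => n; exact: interior_subset (Ux n I).
split; first exact: open_interior.
apply: contrapT => ND; apply: NR.
have [W [[x0 [Wo Wx0]] WU]] := denseNE ND.
have [c c0 hc] : exists2 c, 0 < c & forall y, `|x0 - y| < c -> W y.
  by apply/nbhs_dist; exact: open_nbhs_nbhs.
have [b b0 hb] := fc x0 1 ltr01.
pose r := Num.min c b / 2.
have m0 : 0 < Num.min c b by rewrite lt_min c0 b0.
have r0 : 0 < r by rewrite divr_gt0.
have rc : 2 * r <= c by rewrite mulrC divfK ?gt_eqF // ge_min lexx.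
have rb : 2 * r <= b by rewrite mulrC divfK ?gt_eqF // ge_min lexx orbT.
pose K := `|f x0| + 1.
have K0 : 0 <= K by rewrite addr_ge0.
have fK y : `|x0 - y| < 2 * r -> `|f y| <= K.
  move=> /lt_le_trans /(_ rb) /hb; have := ler_normB (f x0) (f x0 - f y).
  rewrite subKr /K; lra.
have fL := cvx_locally_lipschitz vf r0 K0 fK.
set L := 4 * K / r in fL.
have L0 : 0 <= L by rewrite divr_ge0 ?(ltW r0) // mulr_ge0.
(* Half the threshold of [S n]. If at some scale [x] has all second differences below this half,
   local Lipschitz continuity carries the doubled bound to all neighbours, so [x] is interior to
   [S n]. *)
have e0 : 0 < (2 * n.+1%:R)^-1 :> R by rewrite invr_gt0 mulr_gt0.
apply: (rough_region_has_rough vf r0 L0 e0 fL) => x d xr d0.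
apply: contrapT => N; suff Ux : interior (S n) x.
  have : (W `&` interior (S n)) x by split=> //; apply: hc; lra.
  by rewrite WU.
pose rho := r - `|x0 - x|; have rho0 : 0 < rho by rewrite subr_gt0.
pose d' := Num.min d (rho / 2).
have d'0 : 0 < d' by rewrite lt_min d0 divr_gt0.
have d'd : d' <= d by rewrite ge_min lexx.
have d'r : d' <= rho / 2 by rewrite ge_min lexx orbT.
set e := (2 * n.+1%:R)^-1 in e0 N.
have Nd h : `|h| <= d -> second_diff f x h <= e * d.
  by move=> hd; rewrite leNgt; apply/negP => ?; apply: N; exists h => //; exact: ltW.
have sd := second_diff_shrink vf d'0 d'd Nd.
have ee : n.+1%:R^-1 = 2 * e by rewrite /e; field.
(* Replacing [x] by [y] changes a second difference by at most [4 * L * |x - y|], hence by at most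
   [e * d']. *)
apply/nbhs_dist; exists (Num.min (rho / 2) (e * d' / (4 * (L + 1)))).
  by rewrite lt_min !divr_gt0 // ?mulr_gt0 // ltr_wpDl.
move=> y; rewrite lt_min => /andP[y1 y2]; exists d' => // h hd.
have L10 : 0 < 4 * (L + 1) by rewrite mulr_gt0 // ltr_wpDl.
move: y2; rewrite ltr_pdivlMr // => y2.
have near k z : `|k| <= d' -> `|x - z| < rho / 2 -> `|x0 - (z + k)| < r.
  move=> kd xz; rewrite opprD addrA; apply: le_lt_trans (ler_normB _ _) _.
  have := ler_normD (x0 - x) (x - z); rewrite addrA subrK.
  rewrite /rho in d'r xz rho0; lra.
have xx : `|x - x| < rho / 2 by rewrite subrr normr0 divr_gt0.
have lip k : `|k| <= d' -> `|f (y + k) - f (x + k)| <= L * `|x - y|.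
  move=> kd; apply: le_trans (fL _ _ (near k _ kd y1) (near k _ kd xx)) _.
  by rewrite opprD addrACA subrr addr0 distrC.
have := lip h hd; have := lip (- h); have := lip 0; rewrite normr0 normrN !addr0.
move=> /(_ (ltW d'0)); rewrite !ler_norml => /andP[A1 A2] /(_ hd) /andP[B1 B2] /andP[C1 C2].
have := sd h hd; rewrite /second_diff ee.
have := normr_ge0 (x - y); lra.
Qed.

Lemma not_rough_asplund : ~ has_rough X -> asplund X.
Proof.
move=> NR f cf /convex_functionE vf.
by exists [set x | differentiable f x] => //; exact: dense_differentiable.
Qed.

End Baire.

(** * Frechet normal cones *)

Section Cones.
Variables (R : realType) (X : normedModType R).
Implicit Types (f : X -> R) (A : set X) (x y : X).

Lemma is_lin_linear f : is_lin f <-> linear (f : X -> R^o).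
Proof.
split=> [[fD fZ] a u v|h]; first by rewrite fD fZ.
split=> [u v|t u]; first by have := h 1 u v; rewrite !scale1r.
have f0 : f 0 = 0.
  have := h 1 0 0; rewrite !scale1r addr0 => /esym/eqP.
  by rewrite -subr_eq0 addrK => /eqP.
by have := h t u 0; rewrite !addr0 f0 addr0.
Qed.

Lemma bounded_lin_continuous f L : bounded_lin L f -> continuous (f : X -> R^o).
Proof.
move=> bf; apply: (@lipschitz_continuous _ _ f L) => u v.
by rewrite -(linB _ _ (proj1 bf)); exact: bounded_lin_norm.
Qed.

Lemma dualP f : dual X f <-> exists2 L, 0 <= L & bounded_lin L f.
Proof.
split=> [[/is_lin_linear lf /= /(_ 0)]|[L _ bf]]; last first.
  by split; [exact/is_lin_linear/(proj1 bf)|exact: bounded_lin_continuous bf].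
move=> /cvgrPdist_le /(_ 1 ltr01) /nbhs_dist[d d0 hd].
exists (2 / d); first by rewrite divr_ge0 // ltW.
apply: lin_bounded_ball => // h hh; have := hd h.
by rewrite sub0r normrN => /(_ hh); rewrite (lin0 lf) sub0r normrN; apply: le_trans; exact: ler_norm.
Qed.

Lemma dual_unit_ballP f : dual_unit_ball X f <-> bounded_lin 1 f.
Proof.
split=> [[df nf]|bf].
- have /dualP[L L0 bL] := df.
  have ub y : `|y| <= 1 -> `|f y| <= 1.
    move=> y1; apply: le_trans nf; apply: (sup_img_ge (f := fun y => `|f y|) (c := L)) => // u /= u1.
    by apply: le_trans (bounded_lin_norm _ bL) _; rewrite ler_piMr.
  split; first by case: bL.
  move=> y; have [->|y0] := eqVneq y 0; first by rewrite (lin0 (proj1 bL)) normr0 mulr0.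
  have n0 : 0 < `|y| by rewrite normr_gt0.
  have := ub (`|y|^-1 *: y); rewrite normfZV // lexx => /(_ isT).
  rewrite (proj2 (proj1 bL)) normrM gtr0_norm ?invr_gt0 // ler_pdivrMl // mulr1 mul1r.
  exact: le_trans (ler_norm _).
- split; first by apply/dualP; exists 1.
  apply: (sup_img_le (t := 0) (f := fun y => `|f y|)); first by rewrite /= normr0.
  by move=> y /= y1; apply: le_trans (bounded_lin_norm _ bf) _; rewrite mul1r.
Qed.

(** At [y = x] both sides of the inequality vanish, so the puncture and the quotient of the
    definition disappear. If [x] is isolated in [A], the supremum over the empty set is [-oo], which
    agrees with a condition that is empty for small [d]. *)
Lemma frechet_normal_coneP A x f : frechet_normal_cone A x f <->
  dual X f /\ forall e, 0 < e -> exists2 d, 0 < d &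
    forall y, A y -> `|x - y| < d -> f (y - x) <= e * `|y - x|.
Proof.
split=> [[df H]|[df H]]; split=> //.
- move=> e e0; have : (limf_esup (fun y => (f (y - x) / `|y - x|)%:E) (within A x^') < e%:E)%E.
    by apply: le_lt_trans H _; rewrite lte_fin.
  move=> /ereal_inf_lt[_ [V FV <-]] Ve.
  have [d d0 hd] := (nbhs_dist x _).1 FV; exists d => // y Ay xy.
  have [->|yx] := eqVneq y x.
    have /dualP[L _ [lf _]] := df; by rewrite subrr (lin0 lf) normr0 mulr0.
  have Vy := hd y xy yx Ay.
  have : ((f (y - x) / `|y - x|)%:E < e%:E)%E.
    by apply: le_lt_trans Ve; apply: ereal_sup_ubound; exists y.
  by rewrite lte_fin ltr_pdivrMr ?normr_gt0 ?subr_eq0 // => /ltW.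
- apply/lee_addgt0Pr => e e0; rewrite add0e.
  have [d d0 hd] := H e e0.
  pose V := [set y | [/\ A y, y != x & `|x - y| < d]].
  apply: (@le_trans _ _ (ereal_sup [set (f (y - x) / `|y - x|)%:E | y in V])).
    apply: ereal_inf_lbound; exists V => //.
    by apply/nbhs_dist; exists d => // y xy yx Ay.
  apply: ge_ereal_sup => _ [y [Ay yx xy] <-].
  by rewrite lee_fin ler_pdivrMr ?normr_gt0 ?subr_eq0 //; exact: hd.
Qed.

End Cones.

Section ClosedDist.
Variables (R : realType) (X : normedModType R).

Lemma closed_distP (A : set X) : closed A <->
  forall x, (forall e, 0 < e -> exists2 y, A y & `|x - y| < e) -> A x.
Proof.
split=> [cA x h|h x cx].
  apply: cA => B /nbhs_dist[d d0 hd].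
  by have [y Ay xy] := h d d0; exists y; split=> //; exact: hd.
apply: h => e e0; have [|y [Ay xy]] := cx (ball x e); first exact: nbhsx_ballx.
by exists y => //; rewrite -ball_normE in xy.
Qed.

End ClosedDist.

Lemma le_all_eps (R : realType) (a c : R) : 0 <= c ->
  (forall e, 0 < e -> a <= e * c) -> a <= 0.
Proof.
move=> c0 h; apply/ler_addgt0Pr => e e0; rewrite add0r.
have c1 : 0 < c + 1 by rewrite ltr_wpDl.
apply: le_trans (h (e / (c + 1)) _) _; first by rewrite divr_gt0.
by rewrite mulrAC ler_pdivrMr // ler_pM2l // lerDl.
Qed.

(** * Failure of the intersection rule under roughness *)

Section Counterexample.
Variables (R : realType) (X : normedModType R).
Variables (g : X -> R) (M e : R) (xb : X).
Hypotheses (gs : sublinear g) (gM : forall x, g x <= M * `|x|)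
  (gn : forall x, `|x| <= g x) (e0 : 0 < e) (rg : rough setT e g)
  (M1 : 1 <= M) (gxb : g xb = 1).

Let M0 : 0 < M. Proof. exact: lt_le_trans M1. Qed.

Let gL x y : `|g x - g y| <= M * `|x - y|.
Proof. exact: sublinear_lipschitz. Qed.

Let g0 x : 0 <= g x. Proof. exact: le_trans (gn x). Qed.

Let Mhalf r : r < (2 * M)^-1 -> M * r <= 2^-1.
Proof.
move=> /ltW /(ler_wpM2l (ltW M0)); suff -> : M * (2 * M)^-1 = 2^-1 by [].
by field; rewrite gt_eqF.
Qed.

(** Moving outwards along [x] shows [f x <= 0]. Rescaling [x + h] to the level of [x] stays in the
    set; summing the inequalities obtained for [h] and [- h], the second difference of [g]
    multiplies [- f x], and roughness forces [- f x <= 0]. With [f x = 0], what remains bounds [f h]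
    by an arbitrarily small multiple of [|h|]. *)
Lemma normal_cone_outside x f : 1 <= g x ->
  frechet_normal_cone [set x | 1 <= g x] x f -> forall h, f h = 0.
Proof.
set c := g x => c1 /frechet_normal_coneP[/dualP[L L0 [lf bf]] H].
have c0 : 0 < c by exact: lt_le_trans c1.
pose W := M * `|x| + c; have W0 : 0 < W by rewrite ltr_wpDl // mulr_ge0 // ltW.
(* [x + h] is rescaled to the level set of [x] *)
have key eta : 0 < eta -> exists2 d, 0 < d & forall h, `|h| < d ->
    (c - g (x + h)) * f x + c * f h <= eta * (W * `|h|).
  move=> eta0; have [d d0 hd] := H eta eta0.
  exists (Num.min (2 * M)^-1 (d / (2 * W))).
    by rewrite lt_min invr_gt0 divr_gt0 ?mulr_gt0.
  move=> h; rewrite lt_min ltr_pdivlMr ?mulr_gt0 // => /andP[h1 h2].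
  have {}h1 : M * `|h| <= 2^-1.
    exact: Mhalf.
  set a := g (x + h).
  have ca : `|c - a| <= M * `|h|.
    by apply: le_trans (gL _ _) _; rewrite opprD addrA subrr sub0r normrN.
  have a0 : 2^-1 <= a by move: ca; rewrite ler_norml => /andP[_]; lra.
  have a1 : 0 < a by apply: lt_le_trans a0; rewrite invr_gt0.
  have W1 : `|(c - a) *: x + c *: h| <= W * `|h|.
    apply: le_trans (ler_normD _ _) _; rewrite !normrZ (gtr0_norm c0).
    have := ler_wpM2r (normr_ge0 x) ca; rewrite /W; lra.
  pose y := (c / a) *: (x + h).
  have yx : y - x = a^-1 *: ((c - a) *: x + c *: h).
    rewrite scalerDr !scalerA mulrBr mulVf ?gt_eqF // scalerBl scale1r.
    by rewrite /y (mulrC c) scalerDr addrAC.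
  have yxa : a * `|y - x| <= W * `|h|.
    by rewrite yx normrZ gtr0_norm ?invr_gt0 // mulrA mulfV ?gt_eqF // mul1r.
  have := hd y; rewrite /= (proj2 gs) ?divr_ge0 ?(ltW c0) ?(ltW a1) // -/a.
  rewrite divfK ?gt_eqF // distrC => /(_ c1) hh.
  have {}hh : f (y - x) <= eta * `|y - x|.
    apply: hh; have : 2^-1 * `|y - x| <= a * `|y - x| by rewrite ler_wpM2r.
    lra.
  have : a * f (y - x) <= eta * (W * `|h|).
    apply: (@le_trans _ _ (a * (eta * `|y - x|))); first by rewrite ler_pM2l.
    by rewrite mulrCA ler_pM2l.
  by rewrite yx (proj2 lf) mulrA mulfV ?gt_eqF // mul1r (proj1 lf) !(proj2 lf).
have fx1 : f x <= 0.
  apply: (@le_all_eps _ _ `|x|) => // eta eta0; have [d d0 hd] := H eta eta0.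
  pose s := d / (2 * (`|x| + 1)); have x1 : 0 < `|x| + 1 by rewrite ltr_wpDl.
  have s0 : 0 < s by rewrite divr_gt0 // mulr_gt0.
  have gx : g (x + s *: x) = (1 + s) * c.
    by rewrite -{1}[x]scale1r -scalerDl (proj2 gs) // addr_ge0 // ltW.
  have := hd (x + s *: x); rewrite /= gx.
  rewrite (addrC x (s *: x)) addrK (distrC x) addrK normrZ gtr0_norm // (proj2 lf).
  rewrite mulrCA ler_pM2l //; apply.
    by rewrite -/c; have := mulr_ge0 (ltW s0) (ltW c0); lra.
  by have : s * (2 * (`|x| + 1)) = d; [rewrite divfK // gt_eqF // mulr_gt0|have := mulr_ge0 (ltW s0) (normr_ge0 x); lra].
have fx0 : f x = 0.
  apply/eqP; rewrite eq_le fx1 -oppr_le0 /=.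
  rewrite -(pmulr_rle0 _ e0).
  apply: (@le_all_eps _ _ (2 * W)); first by rewrite mulr_ge0 // ltW.
  move=> eta eta0; have [d d0 hd] := key eta eta0.
  have d20 : 0 < d / 2 by rewrite divr_gt0.
  have [h [_ h1 h2]] := rg (x := x) I d20.
  have hhd : `|h| < d by lra.
  have := hd h hhd; have := hd (- h); rewrite normrN => /(_ hhd).
  rewrite (linN _ lf); move: h2; rewrite /second_diff -/c.
  set a := g _; set b := g _ => h2 A B.
  have C : (a + b - 2 * c) * - f x <= eta * (2 * W) * `|h| by lra.
  have D : e * (d / 2) * - f x <= (a + b - 2 * c) * - f x.
    by rewrite ler_wpM2r // oppr_ge0.
  have : eta * (2 * W) * `|h| <= eta * (2 * W) * (d / 2).
    by rewrite ler_pM2l // !mulr_gt0.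
  by move=> G; rewrite -(ler_pM2r d20); lra.
have fh h : f h <= 0.
  apply: (@le_all_eps _ _ (W / c * `|h|)).
    by rewrite mulr_ge0 // divr_ge0 // ltW.
  move=> eta eta0; have [d d0 hd] := key eta eta0.
  have bl : bounded_lin (eta * (W / c)) f.
    apply: (lin_bounded_near (d := d)) => // k kd; have := hd k kd.
    rewrite fx0 mulr0 add0r -ler_pdivlMl // => hk; apply: le_trans hk _.
    by rewrite le_eqVlt; apply/orP; left; apply/eqP; field; rewrite gt_eqF.
  by rewrite mulrA; case: bl.
move=> h; apply/eqP; rewrite eq_le fh /=; have := fh (- h).
by rewrite (linN _ lf) oppr_le0.
Qed.

Let A0 := [set x | 1 <= g x].
(** The segment from 0 to [xb], with [g x] itself as the parameter; this makes its closedness and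
    the distance estimate direct consequences of the Lipschitz bound on [g]. *)
Let A1 := [set x | x = g x *: xb /\ g x <= 1].

Let gZ t : 0 <= t -> g (t *: xb) = t.
Proof. by move=> t0; rewrite (proj2 gs) // gxb mulr1. Qed.

(** The radius forces [g z >= 1 / 2], so the segment continues from [z] towards the origin, and
    [- xb] is an admissible direction for testing [f]. *)
Lemma normal_cone_segment z f : A1 z -> `|xb - z| < (2 * M)^-1 ->
  frechet_normal_cone A1 z f -> 0 <= f xb.
Proof.
move=> [zE z1] zxb /frechet_normal_coneP[/dualP[L L0 [lf bf]] H].
set t := g z in zE z1.
have t0 : 0 < t.
  have := gL xb z; rewrite gxb ler_norml => /andP[_].
  have := Mhalf zxb.
  by rewrite -/t; lra.
rewrite -oppr_le0; apply: (@le_all_eps _ _ `|xb|) => // eta eta0.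
have [d d0 hd] := H eta eta0.
have x1 : 0 < `|xb| + 1 by rewrite ltr_wpDl.
pose s := Num.min t (d / (2 * (`|xb| + 1))).
have s0 : 0 < s by rewrite lt_min t0 divr_gt0 // mulr_gt0.
have st : s <= t by rewrite ge_min lexx.
have sd : s * (2 * (`|xb| + 1)) <= d.
  by rewrite -ler_pdivlMr ?mulr_gt0 // ge_min lexx orbT.
have := hd ((t - s) *: xb); rewrite zE -scalerBl opprB addrCA subrr addr0.
rewrite -scalerBl addrAC subrr sub0r !normrZ normrN gtr0_norm // (proj2 lf).
rewrite mulNr -mulrN mulrCA ler_pM2l //; apply.
  by rewrite /A1 /= gZ ?subr_ge0 //; split=> //; lra.
by have := mulr_ge0 (ltW s0) (normr_ge0 xb); lra.
Qed.

Let A (i : 'I_2) := if i == ord0 then A0 else A1.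

Let capA : \bigcap_i A i = [set xb].
Proof.
apply/seteqP; split=> [x Ax|x /= ->].
  have /= x0 := Ax ord0 I; have [/= xE x1] := Ax ord_max I.
  have gx : g x = 1 by apply/eqP; rewrite eq_le x1 x0.
  by rewrite /= xE gx scale1r.
move=> i _; rewrite /A; case: ifP => _; first by rewrite /A0 /= gxb.
by rewrite /A1 /= gxb scale1r.
Qed.

Lemma closed_level : closed A0.
Proof.
apply/closed_distP => x h; rewrite /A0 /=; apply/ler_addgt0Pr => r r0.
have [|y y1 xy] := h (r / M); first by rewrite divr_gt0.
have := gL y x; rewrite ler_norml distrC => /andP[_].
move: xy; rewrite ltr_pdivlMr // => xy; rewrite /A0 /= in y1; lra.
Qed.

Lemma closed_segment : closed A1.
Proof.
apply/closed_distP => x h; split; last first.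
  apply/ler_addgt0Pr => r r0.
  have [|y [_ y1] xy] := h (r / M); first by rewrite divr_gt0.
  have := gL x y; rewrite ler_norml => /andP[_].
  move: xy; rewrite ltr_pdivlMr // => xy; lra.
apply/eqP; rewrite -subr_eq0 -normr_le0.
have W0 : 0 < 1 + M * `|xb| by rewrite ltr_wpDr // mulr_ge0 // ltW.
apply: (@le_all_eps _ _ (1 + M * `|xb|)); first exact: ltW.
move=> r r0; have [y [yE _] xy] := h r r0.
have -> : x - g x *: xb = (x - y) - (g x - g y) *: xb.
  by rewrite scalerBl -yE opprB addrA subrK.
apply: le_trans (ler_normB _ _) _; rewrite normrZ.
have := ler_wpM2r (normr_ge0 xb) (gL x y).
have : M * `|x - y| * `|xb| <= M * r * `|xb|.
  by rewrite ler_wpM2r // ler_pM2l // ltW.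
lra.
Qed.

Lemma rough_norm_counterexample :
  exists (A : 'I_2 -> set X) x r f, [/\ forall i, closed (A i),
    (\bigcap_i A i) x, subtransversal A x, 0 < r &
    frechet_normal_cone (\bigcap_i A i) x f /\
    ~ enlargement (fuzzy_cone_sum A x r) r f].
Proof.
have M2 : 0 < (2 * M)^-1 by rewrite invr_gt0 mulr_gt0.
have [p lp ph] := subgradient xb (sublinear_cvx gs).
have pb : bounded_lin M p.
  split=> // h; have := ph h; have := proj1 gs xb h; have := gM h; lra.
have px : 1 <= p xb.
  have := ph (- xb); rewrite subrr (sublinear0 gs) (linN _ lp) gxb; lra.
(* The intersection is the single point [xb], so every bounded functional is normal to it there.
   Fuzzy sums are nonnegative at [xb], and the enlargement lowers them by at most [1 / 2] since
   [|xb| <= 1 <= M], whereas [- p xb <= -1]. *)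
exists A, xb, (2 * M)^-1, (fun x => - p x); split=> //.
- by move=> i; rewrite /A; case: ifP => _; [exact: closed_level|exact: closed_segment].
- by rewrite capA.
- have T0 : 0 < 1 + M * `|xb| by rewrite ltr_wpDr // mulr_ge0 // ltW.
  (* For [y] outside and [z] on the segment, [|z - xb| = (1 - g z) * |xb|] and
     [1 - g z <= g y - g z <= M * |y - z|]. *)
  exists (1 + M * `|xb|), 1; split=> // x _.
  have -> : dist_set x (\bigcap_i A i) = `|x - xb|.
    by rewrite capA /dist_set image_set1 inf1.
  rewrite big_ord_recl big_ord_recl big_ord0 addr0 -ler_pdivrMl // /A /=.
  rewrite -lerBlDr; apply: (le_inf_img (t := xb)); first by rewrite /A0 /= gxb.
  move=> y y1; rewrite /A0 /= in y1; rewrite lerBlDr -lerBlDl.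
  apply: (le_inf_img (t := xb)); first by rewrite /A1 /= gxb scale1r.
  move=> z [zE z1]; rewrite lerBlDl ler_pdivrMl //.
  have E : x - xb = (x - z) - (1 - g z) *: xb.
    by rewrite scalerBl scale1r -zE opprB addrA subrK.
  rewrite E; apply: le_trans (ler_normB _ _) _.
  rewrite normrZ (ger0_norm (x := 1 - g z)) ?subr_ge0 //.
  have : 1 - g z <= M * (`|x - y| + `|x - z|).
    apply: (@le_trans _ _ (M * `|y - z|)).
      by have := gL y z; rewrite ler_norml => /andP[_]; lra.
    rewrite ler_pM2l // (distrC x y); apply: le_trans (ler_normD _ _).
    by rewrite addrA subrK.
  move=> /(ler_wpM2r (normr_ge0 xb)); have := normr_ge0 (x - y); lra.
split.
  have dp : dual X (fun x => - p x).
    apply/dualP; exists M; first exact: ltW.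
    split; last by move=> x; rewrite -(linN _ lp) -[`|x|]normrN; case: pb.
    by split=> [x y|t x]; rewrite ?(proj1 lp) ?(proj2 lp) ?opprD ?mulrN.
  apply/frechet_normal_coneP; split=> // r r0; exists 1 => // y.
  by rewrite capA /= => -> _; rewrite subrr (lin0 lp) normr0 mulr0 oppr0.
move=> [u [xi xiA [v vN <-]] [b /dual_unit_ballP bb] E].
have : \sum_(i < 2) v i xb + (2 * M)^-1 * b xb = - p xb.
  by have := congr1 (fun f => f xb) E; rewrite /= fctE fct_sumE.
clear E.
rewrite big_ord_recl big_ord_recl big_ord0 addr0.
have [xi0 xi0b] := xiA ord0; have [xi1 xi1b] := xiA (lift ord0 ord0).
have -> : v ord0 xb = 0.
  by apply: normal_cone_outside (xi0) (vN ord0) _.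
have v1 : 0 <= v (lift ord0 ord0) xb.
  apply: normal_cone_segment (xi1) _ (vN (lift ord0 ord0)).
  by move: xi1b; rewrite -ball_normE.
have := bounded_lin_norm xb bb; rewrite mul1r ler_norml => /andP[b1 b2].
have xb1 : `|xb| <= 1 by rewrite -gxb.
have : (2 * M)^-1 * - b xb <= 2^-1.
  apply: (@le_trans _ _ ((2 * M)^-1 * 1)); first by rewrite ler_pM2l //; lra.
  by rewrite mulr1 lef_pV2 ?posrE ?mulr_gt0 // ler_peMr.
lra.
Qed.

End Counterexample.

(** The added multiple of the norm is convex and so cannot decrease second differences. Its part
    [|L|] compensates negative values of [s], and the extra 1 gives [|x| <= g x]. *)
Lemma rough_counterexample (R : realType) (X : normedModType R) : has_rough X ->
  exists (A : 'I_2 -> set X) x r f, [/\ forall i, closed (A i),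
    (\bigcap_i A i) x, subtransversal A x, 0 < r &
    frechet_normal_cone (\bigcap_i A i) x f /\
    ~ enlargement (fuzzy_cone_sum A x r) r f].
Proof.
move=> [s [L [e [e0 ss sL rs]]]].
pose g x := s x + (`|L| + 1) * `|x|.
have sL' x : s x <= `|L| * `|x|.
  by apply: le_trans (sL x) _; rewrite ler_wpM2r // ler_norm.
have gs : sublinear g.
  split=> [x y|t x t0]; rewrite /g.
    rewrite addrACA -mulrDr lerD ?(proj1 ss) // ler_wpM2l ?addr_ge0 //.
    exact: ler_normD.
  by rewrite (proj2 ss) // normrZ ger0_norm // mulrDr mulrCA.
have gM x : g x <= (2 * `|L| + 1) * `|x| by rewrite /g; have := sL' x; lra.
have gn x : `|x| <= g x.
  by rewrite /g; have := sublinear_ge x ss; have := sL' (- x); rewrite normrN; lra.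
have rg : rough setT e g.
  move=> x d _ d0; have [h [_ hd he]] := rs x d I d0; exists h; split=> //.
  apply: le_trans he _; rewrite /second_diff /g.
  have : 2 * `|x| <= `|x + h| + `|x - h|.
    have := ler_normD (x + h) (x - h); rewrite addrACA subrr addr0.
    by rewrite -mulr2n normrMn mulr_natl.
  have L0 : 0 <= `|L| + 1 by rewrite addr_ge0.
  by move=> /(ler_wpM2l L0); lra.
have [h [_ _ he]] := rg 0 1 I ltr01.
have h0 : h != 0.
  apply/negP => /eqP hE; move: he.
  by rewrite hE /second_diff oppr0 !addr0 (sublinear0 gs); lra.
have gh : 0 < g h by apply: lt_le_trans (gn h); rewrite normr_gt0.
apply: (rough_norm_counterexample gs gM gn e0 rg (xb := (g h)^-1 *: h)).
  by rewrite lerDr mulr_ge0.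
by rewrite (proj2 gs) ?invr_ge0 ?(ltW gh) // mulVf // gt_eqF.
Qed.

(** * Separability of the dual *)

Section DualSeparable.
Variables (R : realType) (X : normedModType R) (V : set X) (v : nat -> X).
Hypotheses (Vs : is_subspace V)
  (vd : forall x e, V x -> 0 < e -> exists n, `|x - v n| < e).
Implicit Types (p q : X -> R) (e : R).

Definition close_on e p q := forall h, V h -> `|p h - q h| <= e * `|h|.

Let B1 := [set p : X -> R | bounded_lin 1 p].

Lemma bounded_lin0 : bounded_lin 1 (fun _ : X => 0 : R).
Proof. by split; [split=> *; rewrite ?addr0 ?mulr0|move=> x; rewrite mul1r]. Qed.

Definition countably_close e (S : set (X -> R)) := exists2 q : nat -> X -> R,
  forall n, B1 (q n) & forall p, S p -> exists n, close_on e p (q n).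

Lemma countably_close_bigcup e (T : countType) (S : T -> set (X -> R)) :
  (forall t, countably_close e (S t)) -> countably_close e (\bigcup_t S t).
Proof.
move=> h.
have /choice[q qh] : forall t, exists q : nat -> X -> R, (forall n, B1 (q n)) /\
    forall p, S t p -> exists n, close_on e p (q n).
  by move=> t; have [q q1 q2] := h t; exists q.
exists (fun k => if unpickle k is Some (t, n) then q t n else fun=> 0).
  by move=> k; case: unpickle => [[t n]|]; [case: (qh t)|exact: bounded_lin0].
move=> p [t _ Sp]; have [n hn] := (qh t).2 p Sp.
by exists (pickle (t, n)); rewrite pickleK.
Qed.

Lemma countably_closeU e S S' : countably_close e S -> countably_close e S' ->
  countably_close e (S `|` S').
Proof.
move=> h h'; have [|q q1 q2] := @countably_close_bigcup e bool (fun b => if b then S else S').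
  by case.
by exists q => // p [Sp|Sp]; apply: q2; [exists true|exists false].
Qed.

(* Removing from the dual ball its countably coverable half-space slices leaves
   a set all of whose slices are large. *)
Lemma dual_separable e : ~ has_rough X -> 0 < e -> countably_close e B1.
Proof.
move=> NR e0; apply: contrapT => N; apply: NR.
pose O1 (i : nat * rat) := [set p | B1 p /\ ratr i.2 < p (v i.1)].
pose C := [set p | B1 p /\ forall i, O1 i p -> ~ countably_close e (O1 i)].
have rest : countably_close e (B1 `\` C).
  have [|q q1 q2] := @countably_close_bigcup e (nat * rat)%type
      (fun i => if pselect (countably_close e (O1 i)) then O1 i else set0).
    move=> i; case: pselect => [//|n] /=.
    by exists (fun _ _ => 0) => // _; exact: bounded_lin0.
  exists q => // p [Bp /not_andP[//|/existsNP[i /not_implyP[Op /contrapT cl]]]].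
  by apply: q2; exists i => //; case: pselect.
have notsmall S : ~ countably_close e S -> S `<=` B1 -> exists2 p, C p & S p.
  move=> NS SB; apply: contrapT => H; apply: NS; have [q q1 q2] := rest.
  exists q => // p Sp; apply: q2; split; first exact: SB.
  by move=> Cp; apply: H; exists p.
have [p0 Cp0 _] := notsmall _ N (@subset_refl _ _).
have CL p : C p -> bounded_lin 1 p by case.
have [_ _ VZ] := Vs.
apply: (rough_extend _ Vs (sup_lin_sublinear Cp0 CL) _ (e := e / 2) (L := 1)).
- by rewrite divr_gt0.
- by move=> x; apply: (sup_img_le (t := p0) (f := fun p => p x)) => // p /CL[].
apply: (nondentable_rough Cp0 CL e0) => [h t Vh _|x a Vx a0]; first exact: VZ.
have a8 : 0 < a / 8 by rewrite divr_gt0.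
have [p Cp px] : exists2 p, C p & sup [set p x | p in C] - a / 2 < p x.
  by apply: (sup_img_gt (t := p0) (f := fun p => p x)) => //; rewrite ltrBlDr ltrDl divr_gt0.
set S := sup _ in px *.
have [n xn] := vd Vx a8.
have lipx q : B1 q -> `|q x - q (v n)| < a / 8.
  move=> Bq; rewrite -(linB _ _ (proj1 Bq)).
  by apply: le_lt_trans (bounded_lin_norm _ Bq) _; rewrite mul1r.
(* The window leaves [a / 8] on either side for replacing [x] by [v n]: [p] lies in the slice, and
   every member of the slice exceeds [S - a] at [x]. *)
have [|r] := @rat_in_itvoo R (S - 7 * a / 8) (S - 5 * a / 8); first by lra.
rewrite in_itv /= => /andP[r1 r2].
have Op : O1 (n, r) p.
  split; first by case: Cp.
  by have := lipx p (CL _ Cp); rewrite ltr_norml /= => /andP[_]; lra.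
have NO : ~ countably_close e (O1 (n, r)) by case: Cp => _; exact.
(* The functionals within [e] of [p] are covered by [p] alone. Removing them leaves the slice
   uncoverable, so the rest still meets [C]. *)
have [q Cq [Oq nq]] : exists2 q, C q & O1 (n, r) q /\ ~ close_on e q p.
  apply: (notsmall [set q | O1 (n, r) q /\ ~ close_on e q p]); last by move=> q [[]].
  move=> H; apply: NO.
  have [|f f1 f2] := countably_closeU H (S' := [set q | close_on e q p]).
    by exists (fun=> p) => [_|q]; [exact: CL|exists 0%N].
  exists f => // q Oq; apply: f2.
  by have [cq|cq] := pselect (close_on e q p); [right|left].
have [h Vh hh] : exists2 h, V h & e * `|h| < q h - p h.
  move/existsNP: nq => [h /not_implyP[Vh /negP]]; rewrite -ltNge.
  case: ger0P => _ hh; first by exists h.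
  exists (- h); first by rewrite -scaleN1r; exact: VZ.
  by rewrite normrN (linN _ (proj1 (CL _ Cq))) (linN _ (proj1 (CL _ Cp))); lra.
have h0 : 0 < `|h|.
  rewrite normr_gt0; apply/negP => /eqP h0; move: hh.
  rewrite h0 (lin0 (proj1 (CL _ Cq))) (lin0 (proj1 (CL _ Cp))) normr0; lra.
exists q, p, (`|h|^-1 *: h); split=> //.
- case: Oq => Bq /= rq; have := lipx q Bq; rewrite ltr_norml => /andP[]; lra.
- by lra.
split; first exact: VZ.
  by rewrite normfZV // -normr_gt0.
rewrite (proj2 (proj1 (CL _ Cq))) (proj2 (proj1 (CL _ Cp))) -mulrBr.
by rewrite ler_pdivlMl // mulrC ltW.
Qed.

Lemma dual_dense_seq : ~ has_rough X -> exists2 q : nat -> X -> R,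
  forall n, bounded_lin 1 (q n) &
  forall p e, bounded_lin 1 p -> 0 < e -> exists n, close_on e p (q n).
Proof.
move=> NR.
have /choice[q qh] : forall k, exists q : nat -> X -> R, (forall n, B1 (q n)) /\
    forall p, B1 p -> exists n, close_on k.+1%:R^-1 p (q n).
  move=> k; have [|q q1 q2] := @dual_separable k.+1%:R^-1 NR; first by rewrite invr_gt0.
  by exists q.
exists (fun k => if unpickle k is Some (i, n) then q i n else fun=> 0).
  by move=> k; case: unpickle => [[t n]|]; [exact: (qh t).1|exact: bounded_lin0].
move=> p e Bp e0; have [k hk] := ltr_add_invr e0.
have [n hn] := (qh k).2 p Bp; exists (pickle (k, n)); rewrite pickleK => h Vh.
apply: le_trans (hn h Vh) _; rewrite ler_wpM2r //.
by move: hk; rewrite add0r; exact: ltW.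
Qed.

End DualSeparable.

(** * Smooth approximations of the norm *)

Section UltraLimits.
Variables (R : realType) (T : Type) (U : set_system T).
Hypothesis UU : UltraFilter U.

Lemma ultralimit (phi : T -> R) b : (forall t, `|phi t| <= b) ->
  exists l, forall e, 0 < e -> U [set t | `|phi t - l| < e].
Proof.
move=> pb; have Uab : (phi @ U) `[- b, b]%classic.
  by apply: (@filterE _ U) => t; rewrite /= in_itv /= -ler_norml; exact: pb.
have [l [_ cl]] := @segment_compact R (- b) b (phi @ U) _ Uab.
exists l => e e0.
have [//|NU] := in_ultra_setVsetC [set t | `|phi t - l| < e] UU.
have [y [[t nt yt] ye]] := cl (phi @` ~` [set t | `|phi t - l| < e]) (ball l e)
  (filterS (@preimage_image _ _ _ _) NU) (nbhsx_ballx _ _ e0).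
by exfalso; apply: nt; move: ye; rewrite -yt -ball_normE /= distrC.
Qed.

(** Weak-star compactness of dual balls. Linearity survives in the limit because finitely many
    evaluations can be approximated at a common index. *)
Lemma ultralimit_lin (X : normedModType R) (phi : T -> X -> R) L :
  (forall t, bounded_lin L (phi t)) ->
  exists2 p, bounded_lin L p &
    forall x e, 0 < e -> U [set t | `|phi t x - p x| < e].
Proof.
move=> bp; have /choice[p ph] : forall x, exists l, forall e, 0 < e ->
    U [set t | `|phi t x - l| < e].
  by move=> x; apply: (@ultralimit _ (L * `|x|)) => t; exact: bounded_lin_norm.
have lip x y e : 0 < e -> exists t, [/\ `|phi t x - p x| < e, `|phi t y - p y| < e &
    `|phi t (x + y) - p (x + y)| < e].
  move=> e0; have [t [[a b] c]] := filter_ex (filterI (filterI (ph x e e0) (ph y e e0)) (ph (x + y) e e0)).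
  by exists t.
have zero a c : (forall e, 0 < e -> `|a| <= e * c) -> 0 <= c -> a = 0 :> R.
  by move=> h c0; apply/eqP; rewrite -normr_le0; exact: le_all_eps h.
exists p => //; split; last first.
  move=> x; rewrite -subr_le0; apply: (@le_all_eps _ _ 1) => // e e0.
  have [t a] := filter_ex (ph x e e0); move: a => /=; rewrite ltr_norml => /andP[a b].
  have := (bp t).2 x; lra.
split=> [x y|c x]; apply/eqP; rewrite -subr_eq0; apply/eqP.
  apply: (zero _ 3) => // e e0; have [t [a b c]] := lip x y e e0.
  move: a b c; rewrite (proj1 (bp t).1) !ltr_norml ler_norml.
  by move=> /andP[a1 a2] /andP[b1 b2] /andP[c1 c2]; apply/andP; split; lra.
apply: (zero _ (1 + `|c|)); last by rewrite addr_ge0.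
move=> e e0; have [t [a b]] := filter_ex (filterI (ph x e e0) (ph (c *: x) e e0)).
have -> : p (c *: x) - c * p x =
  c * (phi t x - p x) - (phi t (c *: x) - p (c *: x)).
  by rewrite (proj2 (bp t).1); ring.
apply: le_trans (ler_normB _ _) _; rewrite normrM.
move: a b => /= /ltW a /ltW b.
have := ler_wpM2l (normr_ge0 c) a; lra.
Qed.

End UltraLimits.

Section SmoothNorm.
Variables (R : realType) (X : normedModType R) (V : set X).
Hypothesis Vs : is_subspace V.
Variable (pn : nat -> X -> R).
Hypotheses (pnB : forall n, bounded_lin 1 (pn n))
  (pnd : forall p e, bounded_lin 1 p -> 0 < e -> exists n, close_on V e p (pn n)).
Variables (s : R).
Hypothesis s0 : 0 < s.
Implicit Types (p q : X -> R) (x h : X).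

Let U1 := [set h : X | V h /\ `|h| <= 1].
Let U10 : U1 0. Proof. by split; [case: Vs|rewrite normr0]. Qed.

(** The dual norm of [p - q] restricted to [V]. *)
Definition dist_on p q := sup [set p h - q h | h in U1].

Let ub p q h : bounded_lin 1 p -> bounded_lin 1 q -> U1 h -> p h - q h <= 2.
Proof.
move=> bp bq [_ h1]; have := bounded_lin_norm h bp; have := bounded_lin_norm h bq.
by rewrite !mul1r !ler_norml => /andP[? ?] /andP[? ?]; lra.
Qed.

Let dist_on_ge p q h : bounded_lin 1 p -> bounded_lin 1 q -> U1 h ->
  p h - q h <= dist_on p q.
Proof.
move=> bp bq; apply: (sup_img_ge (f := fun h => p h - q h) (c := 2)) => u.
exact: ub.
Qed.

Let dist_on_le p q c : (forall h, U1 h -> p h - q h <= c) -> dist_on p q <= c.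
Proof. exact: (sup_img_le (f := fun h => p h - q h) U10). Qed.

Let dist_on_ge0 p q : bounded_lin 1 p -> bounded_lin 1 q -> 0 <= dist_on p q.
Proof.
move=> bp bq; have := dist_on_ge bp bq U10.
by rewrite (lin0 bp.1) (lin0 bq.1) subrr.
Qed.

Let dist_on_le2 p q : bounded_lin 1 p -> bounded_lin 1 q -> dist_on p q <= 2.
Proof. by move=> bp bq; apply: dist_on_le => h; exact: ub. Qed.

Let dist_on_scale p q h : bounded_lin 1 p -> bounded_lin 1 q -> V h ->
  p h - q h <= dist_on p q * `|h|.
Proof.
move=> bp bq Vh; have [->|h0] := eqVneq h 0.
  by rewrite (lin0 bp.1) (lin0 bq.1) subrr normr0 mulr0.
have n0 : 0 < `|h| by rewrite normr_gt0.
have [_ _ VZ] := Vs.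
have Uh : U1 (`|h|^-1 *: h) by split; [exact: VZ|rewrite normfZV].
have := dist_on_ge bp bq Uh.
by rewrite (proj2 bp.1) (proj2 bq.1) -mulrBr ler_pdivrMl // mulrC.
Qed.

Let dist_on_sym p q : bounded_lin 1 p -> bounded_lin 1 q ->
  dist_on p q <= dist_on q p.
Proof.
move=> bp bq; apply: dist_on_le => h [Vh h1].
have Uh : U1 (- h) by split; [rewrite -scaleN1r; case: Vs => _ _; exact|rewrite normrN].
by have := dist_on_ge bq bp Uh; rewrite (linN _ bp.1) (linN _ bq.1); lra.
Qed.

Let dist_on_triangle p q r : bounded_lin 1 p -> bounded_lin 1 q ->
  bounded_lin 1 r -> dist_on p r <= dist_on p q + dist_on q r.
Proof.
move=> bp bq br; apply: dist_on_le => h Uh.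
have := dist_on_ge bp bq Uh; have := dist_on_ge bq br Uh; lra.
Qed.

Let mid p q := fun x => 2^-1 * (p x + q x).

Let mid_bounded p q : bounded_lin 1 p -> bounded_lin 1 q -> bounded_lin 1 (mid p q).
Proof.
move=> bp bq; rewrite /mid; split; last by move=> x; have := bp.2 x; have := bq.2 x; lra.
split=> [x y|t x]; first by rewrite (proj1 bp.1) (proj1 bq.1); ring.
by rewrite (proj2 bp.1) (proj2 bq.1); ring.
Qed.

Let dist_on_mid p q r : bounded_lin 1 p -> bounded_lin 1 q -> bounded_lin 1 r ->
  dist_on (mid p q) r <= 2^-1 * (dist_on p r + dist_on q r).
Proof.
move=> bp bq br; apply: dist_on_le => h Uh; rewrite /mid.
have := dist_on_ge bp br Uh; have := dist_on_ge bq br Uh; lra.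
Qed.

(** Squared distances in the dual ball are at most 4, so these weights keep the whole series at most
    [s]. *)
Let c n : R := s / 4 * (2^-1) ^+ n.+1.

Let c0 n : 0 < c n.
Proof. by rewrite /c mulr_gt0 ?exprn_gt0 ?invr_gt0 // divr_gt0. Qed.

Let sumc N : \sum_(n < N) c n <= s / 4.
Proof.
suff -> : \sum_(n < N) c n = s / 4 * (1 - (2^-1) ^+ N).
  by rewrite ler_piMr ?(ltW (divr_gt0 _ _)) // lerBlDr lerDl exprn_ge0 // invr_ge0.
elim: N => [|N IH]; first by rewrite big_ord0 expr0 subrr mulr0.
rewrite big_ord_recr /= IH /c exprS; lra.
Qed.

Let T N p := \sum_(n < N) c n * dist_on p (pn n) ^+ 2.

Let T_mono N M p : (N <= M)%N -> T N p <= T M p.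
Proof.
move=> /subnKC <-; elim: (M - N)%N => [|k IH]; first by rewrite addn0.
rewrite addnS; apply: le_trans IH _; rewrite /T big_ord_recr /= lerDl.
by rewrite mulr_ge0 ?sqr_ge0 // ltW.
Qed.

Let T_le N p : bounded_lin 1 p -> T N p <= s.
Proof.
move=> bp; apply: (@le_trans _ _ (\sum_(n < N) c n * 4)).
  apply: ler_sum => n _; rewrite ler_pM2l //.
  have := dist_on_le2 bp (pnB n); have := dist_on_ge0 bp (pnB n); nra.
by rewrite -mulr_suml -ler_pdivlMr.
Qed.

Let T_ge0 N p : 0 <= T N p.
Proof. by apply: sumr_ge0 => n _; rewrite mulr_ge0 ?sqr_ge0 // ltW. Qed.

Definition penalty p := sup [set T N p | N in [set: nat]].

Let T_penalty N p : bounded_lin 1 p -> T N p <= penalty p.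
Proof.
move=> bp; apply: (sup_img_ge (f := fun N => T N p) (c := s)) => // n _.
exact: T_le.
Qed.

Let penalty_le p r : (forall N, T N p <= r) -> penalty p <= r.
Proof. by move=> h; apply: (sup_img_le (t := 0%N) (f := fun N => T N p)). Qed.

(* The quadratic gain comes from the strict convexity of the [n]-th term. *)
Let penalty_mid n p q : bounded_lin 1 p -> bounded_lin 1 q ->
  penalty (mid p q) <= 2^-1 * (penalty p + penalty q) -
    c n * (2^-1 * (dist_on p (pn n) - dist_on q (pn n))) ^+ 2.
Proof.
move=> bp bq; apply: penalty_le => N.
set z := c n * _.
apply: (le_trans (T_mono (mid p q) (leq_maxl N n.+1))).
set M := maxn _ _; have nM : (n < M)%N by rewrite leq_max ltnSn orbT.
have := T_penalty M bp; have := T_penalty M bq.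
suff : T M (mid p q) <= 2^-1 * (T M p + T M q) - z by lra.
rewrite lerBrDr -big_split /= mulr_sumr (bigD1 (Ordinal nM)) //=.
rewrite /T (bigD1 (Ordinal nM)) //= addrAC; apply: lerD.
  rewrite /z; have := dist_on_mid bp bq (pnB n).
  have := dist_on_ge0 (mid_bounded bp bq) (pnB n).
  move: (dist_on _ _) (dist_on p _) (dist_on q _) => a b d a0 ab.
  have aa : a ^+ 2 <= (2^-1 * (b + d)) ^+ 2.
    by rewrite ler_sqr ?nnegrE // (le_trans a0).
  have := ler_wpM2l (ltW (c0 n)) aa; rewrite !expr2; lra.
apply: ler_sum => i _; have := dist_on_mid bp bq (pnB i).
have := dist_on_ge0 (mid_bounded bp bq) (pnB i).
move: (dist_on _ _) (dist_on p _) (dist_on q _) => a b d a0 ab.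
have aa : a ^+ 2 <= 2^-1 * (b ^+ 2 + d ^+ 2).
  apply: (@le_trans _ _ ((2^-1 * (b + d)) ^+ 2)).
    by rewrite ler_sqr ?nnegrE // (le_trans a0).
  by have := sqr_ge0 (b - d); rewrite !expr2; lra.
have := ler_wpM2l (ltW (c0 i)) aa; lra.
Qed.

Let B1 := [set p : X -> R | bounded_lin 1 p].

Let B10 : B1 (fun=> 0). Proof. exact: bounded_lin0. Qed.

Let penalty_ge0 p : B1 p -> 0 <= penalty p.
Proof. by move=> bp; apply: le_trans (T_penalty 0 bp); exact: T_ge0. Qed.

Let penalty_les p : B1 p -> penalty p <= s.
Proof. by move=> bp; apply: penalty_le => N; exact: T_le. Qed.

(** The Fenchel conjugate of [penalty] on the dual ball; without penalty it would be the norm, and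
    the penalty costs at most [s]. Conjugation turns the strict convexity of the penalty into
    smoothness. *)
Definition smooth_norm x := sup [set p x - penalty p | p in B1].
Local Notation G := smooth_norm.

Let G_ge p x : B1 p -> p x - penalty p <= G x.
Proof.
apply: (sup_img_ge (f := fun p => p x - penalty p) (c := `|x|)) => q Bq.
by have := penalty_ge0 Bq; have := Bq.2 x; lra.
Qed.

Let G_le x r : (forall p, B1 p -> p x - penalty p <= r) -> G x <= r.
Proof. exact: (sup_img_le (f := fun p => p x - penalty p) B10). Qed.

Lemma smooth_norm_le x : G x <= `|x|.
Proof.
by apply: G_le => q Bq; have := penalty_ge0 Bq; have := Bq.2 x; lra.
Qed.

Lemma smooth_norm_ge x : `|x| - s <= G x.
Proof.
have nc : cvx (fun x : X => `|x|).
  by apply: sublinear_cvx; split=> [y z|t y t0]; [exact: ler_normD|rewrite normrZ ger0_norm].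
have [p lp ph] := subgradient x nc.
have Bp : B1 p.
  by split=> // h; have := ph h; have := ler_normD x h; lra.
apply: le_trans (G_ge x Bp); have := penalty_les Bp.
have := ph (- x); rewrite subrr normr0 (linN _ lp); lra.
Qed.

Lemma smooth_norm_lipschitz x y : G x <= G y + `|x - y|.
Proof.
apply: G_le => p Bp; have := G_ge y Bp; have := Bp.2 (x - y).
by rewrite (linB _ _ Bp.1); lra.
Qed.

Lemma smooth_norm_cvx : cvx G.
Proof.
move=> t x y t0 t1; apply: G_le => p Bp.
rewrite (proj1 Bp.1) !(proj2 Bp.1).
have := ler_wpM2l t0 (G_ge x Bp).
have t1' : 0 <= 1 - t by rewrite subr_ge0.
have := ler_wpM2l t1' (G_ge y Bp); lra.
Qed.

(** An ultrafilter limit of a maximising sequence. Each [dist_on], being a supremum of evaluations,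
    is lower semicontinuous for pointwise convergence, and this passes to the partial sums. *)
Let maximizer x : exists2 p, B1 p & G x <= p x - penalty p.
Proof.
have /choice[phi ph] : forall k : nat, exists p, B1 p /\ G x - k.+1%:R^-1 < p x - penalty p.
  move=> k; have [||p Bp hp] := @sup_img_gt R _ B1 (fun p => p x - penalty p) (G x - k.+1%:R^-1) (fun=> 0).
  - exact: B10.
  - by rewrite -/(G x) ltrBlDr ltrDl invr_gt0 ltr0n.
  by exists p.
have [U [UU sU]] := @ultraFilterLemma nat \oo _.
have Bphi t : bounded_lin 1 (phi t) by case: (ph t).
have [p Bp hp] := ultralimit_lin UU Bphi.
exists p => //.
suff : penalty p <= p x - G x by lra.
apply: penalty_le => N; rewrite -subr_le0.
apply: (@le_all_eps _ _ (2 + s)); first by rewrite addr_ge0 // ltW.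
move=> e e0.
have near_dist n : U [set t | dist_on p (pn n) <= dist_on (phi t) (pn n) + e].
  have [h Uh hh] : exists2 h, U1 h & dist_on p (pn n) - e / 2 < p h - pn n h.
    apply: (sup_img_gt (t := 0) (f := fun h => p h - pn n h)) => //.
    by rewrite ltrBlDr ltrDl divr_gt0.
  have e2 : 0 < e / 2 by rewrite divr_gt0.
  apply: filterS (hp h _ e2) => t /=; rewrite ltr_norml => /andP[A B].
  have := dist_on_ge (Bphi t) (pnB n) Uh; lra.
have nearN : U [set t | forall n : 'I_N, dist_on p (pn n) <= dist_on (phi t) (pn n) + e].
  apply: (@filter_forall _ _ (fun (n : 'I_N) t => dist_on p (pn n) <= dist_on (phi t) (pn n) + e)).
  by move=> n; exact: near_dist.
have nearoo : U [set t : nat | t.+1%:R^-1 < e].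
  by apply: sU; exact: (near_infty_natSinv_lt (PosNum e0)).
have [t [[A B] C]] := filter_ex (filterI (filterI nearN (hp x e e0)) nearoo).
rewrite /= in A B C; move: B; rewrite ltr_norml => /andP[_ B].
have : T N p <= T N (phi t) + e * s.
  apply: (@le_trans _ _ (\sum_(n < N) (c n * dist_on (phi t) (pn n) ^+ 2 + c n * (4 * e)))).
    apply: ler_sum => n _; rewrite -mulrDr ler_pM2l //.
    have := A n; have := dist_on_ge0 Bp (pnB n); have := dist_on_ge0 (Bphi t) (pnB n).
    have := dist_on_le2 Bp (pnB n); have := dist_on_le2 (Bphi t) (pnB n).
    move: (dist_on p _) (dist_on (phi t) _) => a b b2 a2 b1 a1 ab.
    have h1 : 0 <= (b + e - a) * (a + b) by apply: mulr_ge0; [rewrite subr_ge0|exact: addr_ge0].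
    have h2 : 0 <= e * (4 - a - b) by rewrite mulr_ge0 ?(ltW e0) //; lra.
    rewrite !expr2; lra.
  rewrite big_split /= lerD2l -mulr_suml.
  have e40 : 0 <= 4 * e by rewrite mulr_ge0 // ltW.
  by have := ler_wpM2r e40 (sumc N); lra.
have := T_penalty N (Bphi t); have := (ph t).2; move: C.
by move: (t.+1%:R^-1) => z; lra.
Qed.

(** The midpoint of [p] and a near-maximiser [q] cannot beat the maximum, so [penalty_mid] forces
    [p] and [q] to be almost equally far from [pn n]. Choosing [pn n] close to [p] then makes [q]
    close to [p]. *)
Let strong_maximizer x p eta : B1 p -> G x <= p x - penalty p -> 0 < eta ->
  exists2 tau, 0 < tau & forall q, B1 q -> G x - tau <= q x - penalty q ->
    dist_on q p <= eta.
Proof.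
move=> Bp Gp eta0; have eta4 : 0 < eta / 4 by rewrite divr_gt0.
have [n cn] := pnd Bp eta4.
have dpn : dist_on p (pn n) <= eta / 4.
  apply: dist_on_le => h [Vh h1]; apply: le_trans (ler_norm _) _.
  by apply: le_trans (cn h Vh) _; rewrite ler_piMr // ltW.
exists (2 * (c n * (2^-1 * (eta / 4)) ^+ 2)).
  by rewrite !mulr_gt0 // exprn_gt0 // mulr_gt0 // invr_gt0.
move=> q Bq Gq.
have := G_ge x (mid_bounded Bp Bq); have := penalty_mid n Bp Bq; rewrite {2}/mid => A B.
have : c n * (2^-1 * (dist_on p (pn n) - dist_on q (pn n))) ^+ 2 <=
    c n * (2^-1 * (eta / 4)) ^+ 2 by lra.
rewrite ler_pM2l // => C.
have D : dist_on q (pn n) - dist_on p (pn n) <= eta / 4.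
  rewrite leNgt; apply/negP => lt; move: C; rewrite -sqrrN leNgt => /negP; apply.
  rewrite ltr_sqr ?nnegrE; lra.
have := dist_on_triangle Bq (pnB n) Bp; have := dist_on_sym (pnB n) Bp; lra.
Qed.

(** Near-maximisers at [x + h] and at [x - h] are near-maximisers at [x] up to a multiple of [|h|],
    hence both are close to [p] on [V]. Their difference at [h], plus the slack, bounds the second
    difference. *)
Lemma smooth_norm_smooth x e : V x -> 0 < e ->
  exists2 d, 0 < d & forall h, V h -> `|h| < d -> second_diff G x h <= e * `|h|.
Proof.
move=> Vx e0; have [p Bp Gp] := maximizer x.
have e4 : 0 < e / 4 by rewrite divr_gt0.
have [tau tau0 tauP] := strong_maximizer Bp Gp e4.
exists (tau / (2 + e / 4)); first by rewrite divr_gt0 // addr_gt0.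
move=> h Vh; rewrite ltr_pdivlMr ?addr_gt0 // => hh.
have [->|h0] := eqVneq h 0.
  by rewrite /second_diff oppr0 !addr0 normr0 mulr0; lra.
have n0 : 0 < `|h| by rewrite normr_gt0.
have eh : 0 < e / 4 * `|h| by rewrite mulr_gt0.
have near k : `|k| = `|h| -> exists2 q, B1 q & G (x + k) - e / 4 * `|h| < (q x + q k) - penalty q /\ dist_on q p <= e / 4.
  move=> kh.
  have [||q Bq hq] := @sup_img_gt R _ B1 (fun p => p (x + k) - penalty p) (G (x + k) - e / 4 * `|h|) (fun=> 0).
  - exact: B10.
  - by rewrite -/(G (x + k)) ltrBlDr ltrDl.
  rewrite (proj1 Bq.1) in hq; exists q => //; split=> //; apply: tauP => //.
  have := smooth_norm_lipschitz x (x + k); rewrite opprD addrA subrr sub0r normrN kh.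
  have := bounded_lin_norm k Bq; rewrite mul1r kh ler_norml => /andP[? ?]; lra.
have [p1 B1p [h1 d1]] := near h erefl.
have [p2 B2p [h2 d2]] := near (- h) (normrN h).
have := G_ge x B1p; have := G_ge x B2p.
have A1 := dist_on_scale B1p Bp Vh.
have A2 := dist_on_scale Bp B2p Vh.
have A3 := ler_wpM2r (ltW n0) d1.
have A4 := ler_wpM2r (ltW n0) (le_trans (dist_on_sym Bp B2p) d2).
move: h2; rewrite (linN _ B2p.1) /second_diff => h2; lra.
Qed.

End SmoothNorm.

(** * A smooth variational principle *)

Section Variational.
Variables (R : realType) (E : lmodType R) (W : set E) (N : E -> R).
Implicit Types (f : E -> R) (a b h x : E).

(** Functions live on all of [E] while only directions in [W] are tested. [N] is a bare function so
    that the sum norm on tuples can be used without a normed structure on them. *)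
Definition smooth_at f x := forall e, 0 < e -> exists2 d, 0 < d &
  forall h, W h -> N h < d -> second_diff f x h <= e * N h.

Definition smooth_approx := forall s, 0 < s -> exists H, [/\ cvx H,
  forall a b, H a <= H b + N (a - b), forall a, N a <= H a <= N a + s &
  forall x, W x -> smooth_at H x].

Lemma half_pow_small (e : R) : 0 < e -> exists k : nat, (2^-1) ^+ k < e.
Proof.
move=> e0; have [k hk] := ltr_add_invr e0; exists k; rewrite add0r in hk.
apply: le_lt_trans hk; rewrite exprVn lef_pV2 ?posrE ?exprn_gt0 ?ltr0n //.
by rewrite -natrX ler_nat ltn_expl.
Qed.

Hypotheses (Ws : is_subspace W) (N00 : N 0 = 0) (N0 : forall x, 0 <= N x)
  (ND : forall x y, N (x + y) <= N x + N y) (NN : forall x, N (- x) = N x).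

Let NB x y z : N (x - z) <= N (x - y) + N (y - z).
Proof. by apply: le_trans (ND _ _); rewrite addrA subrK. Qed.

(* Following Borwein and Preiss, smooth penalties centred at successive almost
   minimisers are added to [f0]. *)
Lemma variational_principle (S : set E) f0 L z0 nu rho :
  smooth_approx -> S `<=` W ->
  (forall u : nat -> E, (forall k, S (u k)) ->
    (forall k, N (u k.+1 - u k) <= rho * (2^-1) ^+ k) ->
    exists2 z, S z & forall k, N (z - u k) <= 2 * rho * (2^-1) ^+ k) ->
  cvx f0 -> 0 <= L -> (forall a b, f0 a <= f0 b + L * N (a - b)) ->
  (forall x, W x -> smooth_at f0 x) ->
  0 < nu -> 0 < rho -> S z0 -> (forall b, S b -> f0 z0 <= f0 b + nu * rho / 4) ->
  exists z f, [/\ S z /\ N (z - z0) <= 2 * rho, cvx f,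
    forall b, S b -> f z <= f b, smooth_at f z &
    forall a b, f a - f0 a <= f b - f0 b + 2 * nu * N (a - b)].
Proof.
move=> sa SW Scomp f0c L0 f0L f0s nu0 rho0 Sz0 z0min.
pose w k : R := (2^-1) ^+ k.
have w0 k : 0 < w k by rewrite exprn_gt0 // invr_gt0.
have wS k : w k.+1 = w k / 2 by rewrite /w exprS mulrC.
have w00 : w 0%N = 1 by rewrite /w expr0.
(* [e 0] is the given defect of [z0]. Later, [e k], [e k.+1] and the gap [rho * w k / 4] between
   [H k] and [N] are small enough for a penalty of slope [nu * w k] to force
   [N (Z k.+1 - Z k) <= rho * w k]. *)
pose e k := nu * rho * (w k * w k) / 4.
have e0 k : 0 < e k by rewrite /e !mulr_gt0 ?invr_gt0.
have /choice[H Hh] : forall k, exists H, [/\ cvx H,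
  forall a b, H a <= H b + N (a - b), forall a, N a <= H a <= N a + rho * w k / 4 &
  forall x, W x -> smooth_at H x].
  by move=> k; apply: sa; rewrite !mulr_gt0 ?invr_gt0.
have Hc k : cvx (H k) by case: (Hh k).
have HL k a b : H k a <= H k b + N (a - b) by case: (Hh k).
have Hge k a : N a <= H k a by have [_ _ /(_ a)/andP[]] := Hh k.
have Hle k a : H k a <= N a + rho * w k / 4 by have [_ _ /(_ a)/andP[]] := Hh k.
have Hs k x : W x -> smooth_at (H k) x by have [_ _ _] := Hh k; apply.
(* The guarded statement makes [sel] total, so that the recursion below can use it; the guard holds
   along the sequence because the penalties are nonnegative. *)
have /choice[sel selP] : forall fr : (E -> R) * R, exists z, 0 < fr.2 ->
    (exists c, forall b, S b -> c <= fr.1 b) ->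
    S z /\ forall b, S b -> fr.1 z <= fr.1 b + fr.2.
  move=> [f r]; have [[/= r0 [c hc]]|h] := pselect (0 < r /\ exists c, forall b, S b -> c <= f b); last first.
    by exists z0 => r0 hc; exfalso; apply: h.
  have [|z Sz hz] := @inf_img_lt R _ S f (inf [set f b | b in S] + r) z0 Sz0.
    by rewrite ltrDl.
  exists z => _ _; split=> // b Sb; apply: le_trans (ltW hz) _.
  by rewrite lerD2r; exact: inf_img_le hc Sb.
pose st := fix st k := if k is k'.+1 then
    let f' b := (st k').1 b + nu * w k' * H k' (b - (st k').2) in (f', sel (f', e k))
  else (f0, z0).
pose F k := (st k).1; pose Z k := (st k).2.
have FS k b : F k.+1 b = F k b + nu * w k * H k (b - Z k) by [].
have ZS k : Z k.+1 = sel (F k.+1, e k.+1) by [].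
have nw k : 0 < nu * w k by rewrite mulr_gt0.
have Fmono k b : F k b <= F k.+1 b.
  by rewrite FS lerDl mulr_ge0 ?(ltW (nw k)) //; exact: le_trans (N0 _) (Hge _ _).
have Fge k b : f0 b <= F k b.
  by elim: k => [//|k IH]; exact: le_trans IH (Fmono k b).
have SZ k : S (Z k) /\ forall b, S b -> F k (Z k) <= F k b + e k.
  case: k => [|k].
    by split=> // b Sb; apply: le_trans (z0min b Sb) _; rewrite lerD2l /e w00; lra.
  apply: (selP (F k.+1, e k.+1)) => /=; first exact: e0.
  exists (f0 z0 - nu * rho / 4) => b Sb; have := z0min b Sb; have := Fge k.+1 b; lra.
have ZZ k : N (Z k.+1 - Z k) <= rho * w k.
  have [Sk mk] := SZ k; have [Sk1 mk1] := SZ k.+1.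
  have := mk _ Sk1; have := mk1 _ Sk; rewrite !FS subrr.
  have := ler_wpM2l (ltW (nw k)) (Hge k (Z k.+1 - Z k)).
  have := ler_wpM2l (ltW (nw k)) (Hle k 0).
  rewrite N00 add0r => h1 h2 h3 h4.
  rewrite -(ler_pM2l (nw k)).
  have : e k + e k.+1 + nu * w k * (rho * w k / 4) <= nu * w k * (rho * w k).
    rewrite /e wS; have := mulr_gt0 (mulr_gt0 nu0 rho0) (mulr_gt0 (w0 k) (w0 k)); lra.
  lra.
have [z Sz zZ] := Scomp Z (fun k => (SZ k).1) ZZ.
have Zz0 k : N (Z k - z0) <= 2 * rho * (1 - w k).
  elim: k => [|k IH]; first by rewrite w00 !subrr mulr0 N00.
  by apply: le_trans (NB _ (Z k) _) _; have := ZZ k; rewrite wS; lra.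
have w1 k : w k <= 1.
  by rewrite exprn_ile1 ?invr_ge0 // invf_le1 // ler1n.
have Fub k b : F k b <= f0 b + 2 * nu * (1 - w k) * (N (b - z0) + 3 * rho).
  elim: k => [|k IH]; first by rewrite w00 subrr mulr0 mul0r addr0.
  have HC : H k (b - Z k) <= N (b - z0) + 3 * rho.
    apply: le_trans (Hle k _) _; have := NB b z0 (Z k); have := Zz0 k.
    rewrite -(NN (z0 - Z k)) opprB; have := mulr_gt0 rho0 (w0 k).
    by have := ler_wpM2l (ltW rho0) (w1 k); lra.
  have := ler_wpM2l (ltW (nw k)) HC; rewrite FS wS; lra.
pose f b := sup [set F k b | k in [set: nat]].
have Fle k b : F k b <= f b.
  apply: (sup_img_ge (f := fun k => F k b)
    (c := f0 b + 2 * nu * (N (b - z0) + 3 * rho))) => // j _.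
  apply: le_trans (Fub j b) _; have := N0 (b - z0).
  have : 0 <= nu * w j * (N (b - z0) + 3 * rho).
    by rewrite mulr_ge0 ?(ltW (nw _)) // addr_ge0 // mulr_ge0 // ltW.
  lra.
have fle b r : (forall k, F k b <= r) -> f b <= r.
  by move=> h; apply: (sup_img_le (t := 0%N) (f := fun k => F k b)).
have FM k j b : F k b <= F (k + j)%N b.
  by elim: j => [|j IH]; rewrite ?addn0 // addnS; apply: le_trans IH _.
have Finc K j a b : F (K + j)%N a - F K a <=
    F (K + j)%N b - F K b + 2 * nu * (w K - w (K + j)%N) * N (a - b).
  elim: j => [|j IH]; first by rewrite addn0 !subrr mulr0 mul0r addr0.
  rewrite addnS !FS wS; have := HL (K + j)%N (a - Z (K + j)%N) (b - Z (K + j)%N).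
  rewrite opprB addrA subrK => /(ler_wpM2l (ltW (nw (K + j)%N))); lra.
(* The penalties after stage [K] have total slope [2 * nu * w K]. For large [K] this is negligible,
   so [f] inherits smoothness from [F K]. *)
have finc K a b : f a - F K a <= f b - F K b + 2 * nu * w K * N (a - b).
  rewrite lerBlDr; apply: fle => k; have := FM k K a; rewrite addnC.
  have := Finc K k a b; have := Fle (K + k)%N b.
  have : 0 <= nu * w (K + k)%N * N (a - b) by rewrite mulr_ge0 // ltW.
  lra.
have Fc k : cvx (F k).
  elim: k => [//|k IH] t x y t0 t1; rewrite !FS.
  have -> : t *: x + (1 - t) *: y - Z k = t *: (x - Z k) + (1 - t) *: (y - Z k).
    by rewrite !scalerBr addrACA -opprD -scalerDl subrKC scale1r.
  have := ler_wpM2l (ltW (nw k)) (Hc k t (x - Z k) (y - Z k) t0 t1).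
  have := IH t x y t0 t1; lra.
have FL K a b : F K a <= F K b + (L + 2 * nu) * N (a - b).
  have := Finc 0%N K a b; rewrite add0n w00 => h1; have h2 := f0L a b.
  have : 0 <= nu * w K * N (a - b) by rewrite mulr_ge0 // ltW.
  rewrite /F /= in h1 h2 *; lra.
have Fs k x : W x -> smooth_at (F k) x.
  have [_ WD WZ] := Ws; move=> Wx; elim: k => [|k IH]; first exact: f0s.
  move=> r r0; have r2 : 0 < r / 2 by rewrite divr_gt0.
  have [d1 d10 h1] := IH _ r2.
  have WxZ : W (x - Z k).
    by apply: WD => //; rewrite -scaleN1r; apply: WZ; apply: SW; case: (SZ k).
  have r3 : 0 < r / 2 / (nu * w k) by rewrite divr_gt0.
  have [d2 d20 h2] := Hs k _ WxZ _ r3.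
  exists (Num.min d1 d2) => [|h Wh]; first by rewrite lt_min d10.
  rewrite lt_min => /andP[hd1 hd2]; have := h1 h Wh hd1.
  have := ler_wpM2l (ltW (nw k)) (h2 h Wh hd2).
  have -> : nu * w k * (r / 2 / (nu * w k) * N h) = r / 2 * N h by field; rewrite !gt_eqF.
  rewrite /second_diff !FS.
  rewrite (addrAC x (- Z k) h) (addrAC x (- Z k) (- h)).
  lra.
exists z, f; split.
- split=> //; have := zZ 0%N; rewrite expr0 mulr1; exact.
- move=> t x y t0 t1; apply: fle => k; have := Fc k t x y t0 t1.
  have t1' : 0 <= 1 - t by rewrite subr_ge0.
  have := ler_wpM2l t0 (Fle k x); have := ler_wpM2l t1' (Fle k y); lra.
(* [F K z] is compared with the near-minimum at [Z (K + k)], using a Lipschitz constant that does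
   not depend on the stage; the errors vanish as [k] grows. *)
- move=> b Sb; apply: fle => K; rewrite -subr_le0.
  apply: (@le_all_eps _ _ ((L + 2 * nu) * (2 * rho) + nu * rho)).
    by rewrite addr_ge0 ?mulr_ge0 ?addr_ge0 ?mulr_ge0 // ltW.
  move=> r r0; have [k kr] := half_pow_small r0.
  have wK : w (K + k)%N <= r.
    rewrite /w exprD; apply: le_trans (ltW kr).
    by apply: ler_piMl; [exact: ltW (w0 k)|exact: w1 K].
  have [_ /(_ b Sb)] := SZ (K + k)%N.
  have := FL K z (Z (K + k)%N); have := FM K k (Z (K + k)%N); have := Fle (K + k)%N b.
  have L1 : 0 <= L + 2 * nu by rewrite addr_ge0 // mulr_ge0 // ltW.
  have := ler_wpM2l L1 (zZ (K + k)%N); rewrite -/(w _).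
  have : e (K + k)%N <= nu * rho * w (K + k)%N.
    rewrite /e; have := ler_wpM2l (ltW (w0 (K + k)%N)) (w1 (K + k)%N).
    move=> /(ler_wpM2l (ltW (mulr_gt0 nu0 rho0))).
    have := mulr_gt0 (mulr_gt0 nu0 rho0) (w0 (K + k)%N); lra.
  have C0 : 0 <= (L + 2 * nu) * (2 * rho) + nu * rho.
    by rewrite addr_ge0 ?mulr_ge0 // ltW.
  have := ler_wpM2r C0 wK; lra.
- move=> r r0; have [|K hK] := @half_pow_small (r / (8 * nu)).
    by rewrite divr_gt0 // mulr_gt0.
  rewrite -/(w K) ltr_pdivlMr ?mulr_gt0 // in hK.
  have r2 : 0 < r / 2 by rewrite divr_gt0.
  have [d d0 hd] := Fs K z (SW _ Sz) _ r2.
  exists d => // h Wh hhd; have := hd h Wh hhd.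
  have := finc K (z + h) z; have := finc K (z - h) z.
  have -> : z + h - z = h by rewrite addrAC subrr add0r.
  have -> : z - h - z = - h by rewrite addrAC subrr add0r.
  rewrite NN /second_diff.
  have := ler_wpM2r (N0 h) (ltW hK); lra.
- by move=> a b; have := finc 0%N a b; rewrite w00 mulr1.
Qed.

End Variational.

Lemma separable_smooth_approx (R : realType) (X : normedModType R) (V : set X)
    (v : nat -> X) : ~ has_rough X -> is_subspace V ->
  (forall x e, V x -> 0 < e -> exists n, `|x - v n| < e) ->
  smooth_approx V (fun x : X => `|x|).
Proof.
move=> NR Vs vd s s0.
have [pn pB pd] := dual_dense_seq Vs vd NR.
exists (fun x => smooth_norm V pn s x + s); split.
- move=> t x y t0 t1; have := smooth_norm_cvx Vs pB s0 x y t0 t1; lra.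
- move=> a b; have := smooth_norm_lipschitz Vs pB s0 a b; lra.
- move=> a; have := smooth_norm_ge Vs pB s0 a; have := smooth_norm_le Vs pB s0 a.
  by move=> h1 h2; apply/andP; split; lra.
- move=> x Vx e e0; have [d d0 hd] := smooth_norm_smooth Vs pB pd s0 Vx e0.
  by exists d => // h Vh hh; have := hd h Vh hh; rewrite /second_diff; lra.
Qed.

Section SmoothCalculus.
Variables (R : realType) (E : lmodType R) (W : set E) (N : E -> R).
Hypothesis N0 : forall x, 0 <= N x.
Implicit Types (f g : E -> R).

Lemma smooth_at_scale c f x : 0 <= c -> smooth_at W N f x ->
  smooth_at W N (fun y => c * f y) x.
Proof.
move=> c0 sf e e0; have c1 : 0 < c + 1 by rewrite ltr_wpDl.
have [|d d0 hd] := sf (e / (c + 1)); first by rewrite divr_gt0.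
exists d => // h Wh hh; rewrite /second_diff.
have := ler_wpM2l c0 (hd h Wh hh); rewrite /second_diff.
have e1 : c * (e / (c + 1) * N h) + e / (c + 1) * N h = e * N h.
  by field; rewrite gt_eqF.
have : 0 <= e / (c + 1) * N h by rewrite mulr_ge0 // divr_ge0 // ltW.
lra.
Qed.

Lemma smooth_at_add f g x : smooth_at W N f x -> smooth_at W N g x ->
  smooth_at W N (fun y => f y + g y) x.
Proof.
move=> sf sg e e0; have e2 : 0 < e / 2 by rewrite divr_gt0.
have [d d0 hd] := sf _ e2; have [d' d0' hd'] := sg _ e2.
exists (Num.min d d') => [|h Wh]; first by rewrite lt_min d0.
rewrite lt_min => /andP[h1 h2]; have := hd h Wh h1; have := hd' h Wh h2.
rewrite /second_diff; lra.
Qed.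

Lemma smooth_at_cst c x : smooth_at W N (fun=> c) x.
Proof.
move=> e e0; exists 1 => // h _ _.
by rewrite /second_diff; have := mulr_ge0 (ltW e0) (N0 h); lra.
Qed.

Lemma smooth_at_sum (I : Type) (r : seq I) (f : I -> E -> R) x :
  (forall i, smooth_at W N (f i) x) -> smooth_at W N (fun y => \sum_(i <- r) f i y) x.
Proof.
move=> sf; elim: r => [|i r IH].
  by under eq_fun do rewrite big_nil; exact: smooth_at_cst.
by under eq_fun do rewrite big_cons; exact: smooth_at_add.
Qed.

Lemma cvx_sum (I : Type) (r : seq I) (f : I -> E -> R) :
  (forall i, cvx (f i)) -> cvx (fun y => \sum_(i <- r) f i y).
Proof.
move=> cf; elim: r => [|i r IH] t x y t0 t1; first by rewrite !big_nil !mulr0 addr0.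
by rewrite !big_cons; have := cf i t x y t0 t1; have := IH t x y t0 t1; lra.
Qed.

End SmoothCalculus.

Lemma smooth_at_comp (R : realType) (E X : lmodType R) (W : set E) (N : E -> R)
    (V : set X) (M : X -> R) (A : E -> X) (K : R) (f : X -> R) (x : E) :
  (forall a b, A (a - b) = A a - A b) -> (forall a b, A (a + b) = A a + A b) ->
  0 < K -> (forall h, M (A h) <= K * N h) -> (forall h, W h -> V (A h)) ->
  smooth_at V M f (A x) -> smooth_at W N (fun y => f (A y)) x.
Proof.
move=> AB AD K0 AK WV sf e e0; have [|d d0 hd] := sf (e / K); first by rewrite divr_gt0.
exists (d / K) => [|h Wh]; first by rewrite divr_gt0.
rewrite ltr_pdivlMr // mulrC => hh.
have := hd (A h) (WV _ Wh) (le_lt_trans (AK h) hh).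
rewrite /second_diff AB AD => h1; apply: le_trans h1 _.
have := AK h; rewrite -[K * _]mulrC -ler_pdivrMr // => h1.
by rewrite mulrAC -mulrA ler_pM2l.
Qed.

Lemma complete_geometric (R : realType) (X : completeNormedModType R) (u : nat -> X) (rho : R) :
  (forall k, `|u k.+1 - u k| <= rho * (2^-1) ^+ k) ->
  exists l, forall k, `|l - u k| <= 2 * rho * (2^-1) ^+ k.
Proof.
move=> hu; pose w k : R := (2^-1) ^+ k.
have rho0 : 0 <= rho by have := le_trans (normr_ge0 _) (hu 0%N); rewrite expr0 mulr1.
have w0 k : 0 < w k by rewrite exprn_gt0 // invr_gt0.
have inc k j : `|u (k + j)%N - u k| <= 2 * rho * (w k - w (k + j)%N).
  elim: j => [|j IH]; first by rewrite addn0 !subrr normr0 mulr0.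
  rewrite addnS -(subrK (u (k + j)%N) (u _.+1)) -addrA.
  apply: le_trans (ler_normD _ _) _; have := hu (k + j)%N.
  have -> : w (k + j).+1 = w (k + j)%N / 2 by rewrite /w exprS mulrC.
  rewrite -/(w _); lra.
have inc' k j : `|u (k + j)%N - u k| <= 2 * rho * w k.
  apply: le_trans (inc k j) _; rewrite ler_wpM2l ?mulr_ge0 //.
  by rewrite lerBlDr lerDl ltW.
have cu : cvg (u @ \oo).
  apply/cauchy_cvgP/cauchy_exP => e e0.
  have c0 : 0 < 2 * rho + 1 by rewrite ltr_wpDl // mulr_ge0.
  have [k hk] : exists k, w k < e / (2 * rho + 1) by apply: half_pow_small; rewrite divr_gt0.
  exists (u k); exists k => // n /= kn.
  rewrite -ball_normE /= distrC -(subnKC kn); apply: le_lt_trans (inc' k _) _.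
  by move: hk; rewrite ltr_pdivlMr //; have := w0 k; lra.
exists (lim (u @ \oo)) => k; apply/ler_addgt0Pr => e e0.
have /cvgrPdist_lt /(_ e e0) [j _ hj] := cu.
have := hj (k + j)%N (leq_addl _ _) => /= h1.
rewrite -(subrK (u (k + j)%N) (lim _)) -addrA.
apply: le_trans (ler_normD _ _) _; have := inc' k j; rewrite /w; lra.
Qed.

(** * The intersection rule relative to a separable subspace *)

Section Tuples.
Variables (R : realType) (X : normedModType R) (m : nat).
Implicit Types (a b h : 'I_m -> X) (x : X) (i : 'I_m) (V : set X).

Definition tnorm h : R := \sum_i `|h i|.

Definition tuples V : set ('I_m -> X) := [set h | forall i, V (h i)].

Definition single i x : 'I_m -> X := fun j => if j == i then x else 0.

Lemma tnorm0 : tnorm 0 = 0.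
Proof. by rewrite /tnorm big1 // => i _; rewrite normr0. Qed.

Lemma tnorm_ge0 h : 0 <= tnorm h.
Proof. exact: sumr_ge0. Qed.

Lemma tnormN h : tnorm (- h) = tnorm h.
Proof. by apply: eq_bigr => i _; rewrite normrN. Qed.

Lemma tnormD a b : tnorm (a + b) <= tnorm a + tnorm b.
Proof. by rewrite -big_split /=; apply: ler_sum => i _; exact: ler_normD. Qed.

Lemma tnorm_proj h i : `|h i| <= tnorm h.
Proof. by rewrite /tnorm (bigD1 i) //= lerDl; exact: sumr_ge0. Qed.

Lemma tnorm_single i x : tnorm (single i x) = `|x|.
Proof.
rewrite /tnorm (bigD1 i) //= /single eqxx big1 ?addr0 // => j /negbTE ->.
by rewrite normr0.
Qed.

Lemma tnorm_cst x : tnorm (fun=> x) = m%:R * `|x|.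
Proof. by rewrite /tnorm sumr_const card_ord mulr_natl. Qed.

Lemma sum_single h : \sum_i single i (h i) = h.
Proof.
apply/funext => j; rewrite fct_sumE (bigD1 j) //= /single eqxx big1 ?addr0 //.
by move=> i; rewrite eq_sym => /negbTE ->.
Qed.

Lemma singleD i x y : single i (x + y) = single i x + single i y.
Proof.
apply/funext => j; rewrite -[RHS]/(single i x j + single i y j) /single.
by case: ifP => //; rewrite addr0.
Qed.

Lemma singleZ i t x : single i (t *: x) = t *: single i x.
Proof.
apply/funext => j; rewrite /single /=.
by rewrite -[RHS]/(t *: (if j == i then x else 0)); case: ifP => //; rewrite scaler0.
Qed.

Lemma tuples_subspace V : is_subspace V -> is_subspace (tuples V).
Proof. by move=> [V0 VD VZ]; split=> [i|x y Wx Wy i|t x Wx i];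
  [exact: V0|exact: VD|exact: VZ]. Qed.

Lemma tuples_single V i x : is_subspace V -> V x -> tuples V (single i x).
Proof. by move=> [V0 _ _] Vx j; rewrite /single; case: ifP. Qed.

Lemma tuples_smooth_approx V : is_subspace V ->
  smooth_approx V (fun x : X => `|x|) -> smooth_approx (tuples V) tnorm.
Proof.
move=> Vs sa s s0; have m1 : 0 < m%:R + 1 :> R by rewrite ltr_wpDl.
have [|G [Gc GL Gn Gs]] := sa (s / (m%:R + 1)); first by rewrite divr_gt0.
exists (fun h => \sum_i G (h i)); split.
- by apply: cvx_sum => i t x y t0 t1; exact: Gc.
- move=> a b; rewrite /tnorm -big_split /=; apply: ler_sum => i _; exact: GL.
- move=> a; apply/andP; split.
    by apply: ler_sum => i _; have /andP[] := Gn (a i).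
  apply: (@le_trans _ _ (\sum_i (`|a i| + s / (m%:R + 1)))).
    by apply: ler_sum => i _; have /andP[] := Gn (a i).
  rewrite big_split /= lerD2l sumr_const card_ord -[X in X <= _]mulr_natl mulrCA ler_piMr ?(ltW s0) //.
  by rewrite ler_pdivrMr // mul1r lerDl.
- move=> x Wx; apply: smooth_at_sum => [|i]; first exact: tnorm_ge0.
  apply: (@smooth_at_comp _ _ _ _ _ V (fun x => `|x|) (fun h => h i) 1) => //.
  + by move=> h; rewrite mul1r; exact: tnorm_proj.
  + exact: Gs.
Qed.

End Tuples.

Section FuzzyOnSubspace.
Variables (R : realType) (X : completeNormedModType R) (V : set X) (m : nat).

(** By the assumed inequality, the constant tuple [xb] almost minimises [f0] over tuples from the
    sets, where coordinate [i0] carries [p] and disagreement between coordinates is charged at rate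
    [M]. At the minimiser of the perturbed function, single coordinates yield normals along [V];
    shifting all coordinates together leaves the disagreement unchanged and yields the sum estimate
    on all of [X]. *)
Lemma fuzzy_on_subspace (i0 : 'I_m) (A : 'I_m -> set X) (xb : X) (p : X -> R)
    (eps r M Lp : R) :
  is_subspace V -> closed V -> smooth_approx V (fun x : X => `|x|) ->
  (forall i, closed (A i)) -> V xb -> (forall i, A i xb) ->
  0 <= Lp -> bounded_lin Lp p -> 0 < eps -> 0 < r -> 0 <= M ->
  (forall b : 'I_m -> X, (forall i, A i (b i) /\ `|xb - b i| < r) ->
    p (b i0 - xb) <= eps * `|b i0 - xb| + M * \sum_i `|b i - b i0|) ->
  exists (z : 'I_m -> X) (q : 'I_m -> X -> R) (K : R),
  [/\ forall i, [/\ A i (z i), V (z i) & `|xb - z i| < r],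
    0 <= K /\ forall i, bounded_lin K (q i),
    forall i e, 0 < e -> exists2 d, 0 < d & forall y, A i y -> V y ->
      `|z i - y| < d -> q i (y - z i) <= e * `|y - z i| &
    forall h, `|p h - \sum_i q i h| <= 64 * m%:R * eps * `|h|].
Proof.
move=> Vs cV sa cA Vxb Axb Lp0 bp eps0 r0 M0 H.
have m1 : 0 < m%:R + 1 :> R by rewrite ltr_wpDl.
pose N := @tnorm R X m; pose W := tuples (m := m) V.
pose s := eps * r / (2 * (M * m%:R + 1)).
have Mm : 0 < M * m%:R + 1 by rewrite ltr_wpDl // mulr_ge0.
have s0 : 0 < s by rewrite divr_gt0 // mulr_gt0.
have sE : M * m%:R * s <= eps * r / 2.
  have : s * (2 * (M * m%:R + 1)) = eps * r by rewrite divfK // gt_eqF // mulr_gt0.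
  lra.
have [G [Gc GL Gn Gs]] := sa s s0.
pose f0 (b : 'I_m -> X) := M * (\sum_i G (b i - b i0)) + - p (b i0 - xb).
pose S := [set b : 'I_m -> X | forall i, [/\ A i (b i), V (b i) & `|xb - b i| <= r / 2]].
have lpN (a b : 'I_m -> X) : - p (a i0 - xb) <= - p (b i0 - xb) + Lp * N (a - b).
  have := bounded_lin_norm (a i0 - b i0) bp; rewrite !(linB _ _ bp.1) ler_norml => /andP[h1 _].
  have := ler_wpM2l Lp0 (tnorm_proj (a - b) i0); rewrite -[(a - b) i0]/(a i0 - b i0) -/N; lra.
have lin_p (b : 'I_m -> X) (y : X) : - p (y - xb) = - p y + p xb.
  by rewrite (linB _ _ bp.1); ring.
have f0c : cvx f0.
  move=> t x y t0 t1; rewrite /f0.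
  have cG i : cvx (fun b : 'I_m -> X => G (b i - b i0)).
    move=> u a b u0 u1; apply: le_trans (Gc u _ _ u0 u1).
    rewrite -[(u *: a + (1 - u) *: b) i]/(u *: a i + (1 - u) *: b i).
    rewrite -[(u *: a + (1 - u) *: b) i0]/(u *: a i0 + (1 - u) *: b i0).
    by rewrite opprD addrACA !scalerBr.
  have := ler_wpM2l M0 (cvx_sum (index_enum 'I_m) cG x y t0 t1).
  rewrite -[(t *: x + (1 - t) *: y) i0]/(t *: x i0 + (1 - t) *: y i0).
  rewrite !lin_p // (proj1 bp.1) !(proj2 bp.1); lra.
pose L := M * (1 + m%:R) + Lp.
have L0 : 0 <= L by rewrite addr_ge0 // mulr_ge0 // addr_ge0.
have f0L (a b : 'I_m -> X) : f0 a <= f0 b + L * N (a - b).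
  have h1 : \sum_i G (a i - a i0) <= \sum_i G (b i - b i0) + (1 + m%:R) * N (a - b).
    apply: (@le_trans _ _ (\sum_i (G (b i - b i0) + (`|(a - b) i| + N (a - b))))).
      apply: ler_sum => i _; apply: le_trans (GL _ (b i - b i0)) _.
      rewrite lerD2l opprD addrACA; apply: le_trans (ler_normD _ _) _.
      rewrite lerD // -opprD normrN; exact: (tnorm_proj (a - b) i0).
    rewrite !big_split /= lerD2l mulrDl mul1r lerD2l sumr_const card_ord.
    by rewrite mulr_natl.
  have := ler_wpM2l M0 h1; have := lpN a b; rewrite /f0 /L; lra.
have f0s (x : 'I_m -> X) : W x -> smooth_at W N f0 x.
  have [_ VD VZ] := Vs => Wx; rewrite /f0; apply: smooth_at_add.
    apply: smooth_at_scale => //; first exact: tnorm_ge0.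
    apply: smooth_at_sum => [|i]; first exact: tnorm_ge0.
    have VB (h : 'I_m -> X) : W h -> V (h i - h i0).
      by move=> Wh; apply: VD => //; rewrite -scaleN1r; exact: VZ.
    apply: (@smooth_at_comp _ _ _ _ _ V (fun x => `|x|) (fun h => h i - h i0) 2) => //.
    + move=> a b; rewrite -[(a - b) i]/(a i - b i) -[(a - b) i0]/(a i0 - b i0).
      by rewrite !opprD !opprK addrACA.
    + move=> a b; rewrite -[(a + b) i]/(a i + b i) -[(a + b) i0]/(a i0 + b i0).
      by rewrite opprD addrACA.
    + move=> h; apply: le_trans (ler_normB _ _) _.
      by have := tnorm_proj h i; have := tnorm_proj h i0; rewrite -/N; lra.
    + exact: Gs (VB _ Wx).
  move=> e e0; exists 1 => // h _ _; rewrite /second_diff !lin_p //.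
  rewrite -[(x + h) i0]/(x i0 + h i0) -[(x - h) i0]/(x i0 - h i0).
  rewrite (linB _ _ bp.1) (proj1 bp.1).
  have := mulr_ge0 (ltW e0) (tnorm_ge0 h); rewrite -/N; lra.
pose z0 : 'I_m -> X := fun=> xb.
have Sz0 : S z0 by move=> i; split=> //; rewrite subrr normr0 divr_ge0 // ltW.
(* With [rho = r / 8] this gives [nu * rho / 4 = eps * r], the defect of [z0]: one half comes from
   [eps * |b i0 - xb|], the other from the gap [s] of [G]. As [2 * rho + r / 8 < r / 2], steps of
   size [r / 8] from [z] respect the bound in [S]. *)
have nu0 : 0 < 32 * eps by rewrite mulr_gt0.
have rho0 : 0 < r / 8 by rewrite divr_gt0.
have z0min b : S b -> f0 z0 <= f0 b + 32 * eps * (r / 8) / 4.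
  move=> Sb.
  have -> : f0 z0 = M * (m%:R * G 0).
    rewrite /f0 /z0 !subrr (lin0 bp.1) oppr0 addr0 sumr_const card_ord.
    by rewrite -[G 0 *+ m]mulr_natl.
  have h1 : p (b i0 - xb) <= eps * `|b i0 - xb| + M * \sum_i `|b i - b i0|.
    by apply: H => i; have [? _ ?] := Sb i; split=> //; lra.
  have h2 : M * \sum_i `|b i - b i0| <= M * \sum_i G (b i - b i0).
    by apply: ler_wpM2l => //; apply: ler_sum => i _; have /andP[] := Gn (b i - b i0).
  have h3 : eps * `|b i0 - xb| <= eps * (r / 2).
    by rewrite ler_pM2l // distrC; case: (Sb i0).
  have h4 : M * (m%:R * G 0) <= M * m%:R * s.
    rewrite -mulrA ler_wpM2l // ler_wpM2l //.
    by have /andP[_] := Gn 0; rewrite normr0 add0r.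
  rewrite /f0; lra.
have Scomp (u : nat -> 'I_m -> X) : (forall k, S (u k)) ->
    (forall k, N (u k.+1 - u k) <= r / 8 * (2^-1) ^+ k) ->
    exists2 z, S z & forall k, N (z - u k) <= 2 * (r / 8) * (2^-1) ^+ k.
  move=> Su hu.
  have /choice[z hz] : forall i, exists l, forall k, `|l - u k i| <= 2 * (r / 8) * (2^-1) ^+ k.
    move=> i; apply: complete_geometric => k; apply: le_trans (hu k).
    exact: (tnorm_proj (u k.+1 - u k) i).
  have zu i e : 0 < e -> exists k, `|z i - u k i| < e.
    move=> e0; have [|k hk] := @half_pow_small _ (e / (2 * (r / 8))).
      by rewrite divr_gt0 // mulr_gt0.
    exists k; apply: le_lt_trans (hz i k) _.
    by rewrite mulrC -ltr_pdivlMr ?mulr_gt0.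
  exists z.
    move=> i; split.
    + apply: ((closed_distP _).1 (cA i)) => e e0; have [k hk] := zu i e e0.
      by exists (u k i) => //; case: (Su k i).
    + apply: ((closed_distP _).1 cV) => e e0; have [k hk] := zu i e e0.
      by exists (u k i) => //; case: (Su k i).
    + apply/ler_addgt0Pr => e e0; have [k hk] := zu i e e0.
      rewrite -(subrK (u k i) xb) -addrA; apply: le_trans (ler_normD _ _) _.
      by have [_ _ h1] := Su k i; rewrite (distrC (u k i)); lra.
  have inc k j : N (u (k + j)%N - u k) <= 2 * (r / 8) * ((2^-1) ^+ k - (2^-1) ^+ (k + j)).
    elim: j => [|j IH]; first by rewrite addn0 !subrr mulr0 /N tnorm0.
    rewrite addnS -(subrK (u (k + j)%N) (u _.+1)) -addrA.
    apply: le_trans (tnormD _ _) _; have := hu (k + j)%N; rewrite -/N exprS; lra.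
  move=> k; rewrite -subr_le0; apply: (@le_all_eps _ _ (m%:R * (2 * (r / 8)))).
    by rewrite mulr_ge0 // mulr_ge0 // ltW.
  move=> e e0; have [j hj] := half_pow_small e0.
  have h1 : N (z - u (k + j)%N) <= m%:R * (2 * (r / 8) * (2^-1) ^+ (k + j)).
    rewrite mulr_natl -[X in _ *+ X]card_ord -sumr_const.
    by apply: ler_sum => i _; exact: hz.
  have h2 : (2^-1) ^+ (k + j) <= e.
    rewrite exprD; apply: le_trans (ltW hj); apply: ler_piMl.
      by rewrite exprn_ge0 // invr_ge0.
    by rewrite exprn_ile1 ?invr_ge0 // invf_le1 // ler1n.
  have h3 : N (z - u k) <= N (z - u (k + j)%N) + N (u (k + j)%N - u k).
    by apply: le_trans (tnormD _ _); rewrite addrA subrK.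
  have := inc k j; have h4 : 0 <= 2 * (r / 8) by rewrite mulr_ge0 // ltW.
  have : m%:R * (2 * (r / 8)) * (2^-1) ^+ (k + j) <= m%:R * (2 * (r / 8)) * e.
    by rewrite ler_wpM2l // mulr_ge0.
  have : 0 <= 2 * (r / 8) * (2^-1) ^+ (k + j) :> R.
    by rewrite mulr_ge0 // exprn_ge0 // invr_ge0.
  rewrite mulrBr; lra.
have SW : S `<=` W by move=> b Sb i; case: (Sb i).
have [z [f [[Sz zz0] fc zmin fs fL]]] :=
  variational_principle (tuples_subspace m Vs) (@tnorm0 R X m) (@tnorm_ge0 R X m)
    (@tnormD R X m) (@tnormN R X m) (tuples_smooth_approx m Vs sa) SW Scomp f0c L0
    f0L f0s nu0 rho0 Sz0 z0min.
have [P lP hP] := subgradient z fc.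
(* The sign: since [f (z + k) >= f z], smallness of the second difference bounds [f (z - k) - f z]
   from above, hence [P (- k)]. *)
pose q i x := - P (single i x).
have fLip h : P h <= (L + 2 * (32 * eps)) * N h.
  have := hP h; have := fL (z + h) z; have := f0L (z + h) z.
  have -> : z + h - z = h by rewrite addrAC subrr add0r.
  rewrite -/N; lra.
have K0 : 0 <= L + 2 * (32 * eps) by rewrite addr_ge0 // mulr_ge0 // mulr_ge0 // ltW.
exists z, q, (L + 2 * (32 * eps)); split.
- move=> i; have [Ai Vi _] := Sz i; split=> //.
  have := tnorm_proj (z - z0) i; rewrite -[(z - z0) i]/(z i - xb) distrC.
  move: zz0; rewrite -/N; lra.
- split=> // i; split.
    split=> [x y|t x]; rewrite /q; first by rewrite singleD (proj1 lP) opprD.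
    by rewrite singleZ (proj2 lP) mulrN.
  move=> x; rewrite /q -(linN _ lP); apply: le_trans (fLip _) _.
  by rewrite /N tnormN tnorm_single.
- move=> i e e0; have [d d0 hd] := fs e e0.
  exists (Num.min d (r / 8)) => [|y Ay Vy]; first by rewrite lt_min d0.
  rewrite lt_min => /andP[yd yr]; pose k := single i (y - z i).
  have [_ VD VZ] := Vs; have [_ Vzi _] := Sz i.
  have Wk : W k.
    by apply: tuples_single => //; apply: VD => //; rewrite -scaleN1r; exact: VZ.
  have Nk : N k = `|y - z i| by exact: tnorm_single.
  have Szk : S (z + k).
    move=> j; have [Aj Vj _] := Sz j.
    rewrite -[(z + k) j]/(z j + k j) /k /single; case: eqP => [->|_].
      rewrite subrKC; split=> //.
      rewrite -(subrK (z i) xb) -addrA; apply: le_trans (ler_normD _ _) _.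
      have := tnorm_proj (z - z0) i; rewrite -[(z - z0) i]/(z i - xb) (distrC _ xb).
      move: zz0; rewrite -/N; lra.
    by rewrite addr0; split=> //; case: (Sz j).
  have Nkd : N k < d by rewrite Nk distrC.
  have := hd k Wk Nkd; have := zmin _ Szk; have := hP (- k); have := hP k.
  rewrite (linN _ lP) /second_diff -/(N k) Nk /q -/k; lra.
(* The slope [2 * nu = 64 * eps] of [f - f0], times the norm [m * |h|] of a constant tuple. *)
- have PT h : P (fun=> h) <= - p h + 64 * eps * (m%:R * `|h|).
    have := hP (fun=> h); have := fL (z + (fun=> h)) z.
    have -> : z + (fun=> h) - z = (fun=> h) by rewrite addrAC subrr add0r.
    rewrite tnorm_cst /f0.
    have -> : (z + (fun=> h)) i0 = z i0 + h by [].
    have -> : \sum_i G ((z + (fun=> h)) i - (z i0 + h)) = \sum_i G (z i - z i0).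
      apply: eq_bigr => i _; rewrite -[(z + _) i]/(z i + h).
      by rewrite opprD addrACA subrr addr0.
    by rewrite !lin_p // (proj1 bp.1); lra.
  have sumq h : \sum_i q i h = - P (fun=> h).
    rewrite -(sum_single (fun=> h)) (lin_sum _ _ lP) -sumrN.
    by apply: eq_bigr.
  move=> h; rewrite sumq opprK ler_norml; apply/andP; split; last first.
    by have := PT h; lra.
  have := PT (- h); have -> : (fun=> - h) = - (fun=> h) :> ('I_m -> X) by [].
  rewrite (linN _ lP) (linN _ bp.1) normrN; lra.
Qed.

End FuzzyOnSubspace.

(** * Separable reduction *)

(** The sequence enumerates the values of all finite terms over the operations, coded as trees with
    natural labels. *)
Lemma countable_closure (T : Type) (x0 : T) (op : nat -> seq T -> T) :
  exists v : nat -> T, (exists k, v k = x0) /\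
    forall c (ns : seq nat), exists k, v k = op c [seq v n | n <- ns].
Proof.
pose ev := fix ev (t : GenTree.tree nat) : T :=
  match t with GenTree.Leaf _ => x0 | GenTree.Node c ts => op c [seq ev t | t <- ts] end.
pose dec k := if unpickle k is Some t then t else GenTree.Leaf 0%N.
exists (fun k => ev (dec k)); split.
  by exists (pickle (GenTree.Leaf 0%N)); rewrite /dec pickleK.
move=> c ns; exists (pickle (GenTree.Node c [seq dec n | n <- ns])).
by rewrite /dec pickleK /= -map_comp.
Qed.

Section ClosedSpan.
Variables (R : realType) (X : normedModType R) (v : nat -> X).

Definition closure_of : set X := [set x | forall e, 0 < e -> exists n, `|x - v n| < e].

Lemma closure_of_mem n : closure_of (v n).
Proof. by move=> e e0; exists n; rewrite subrr normr0. Qed.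

Lemma closure_of_closed : closed closure_of.
Proof.
apply/closed_distP => x h e e0; have e2 : 0 < e / 2 by rewrite divr_gt0.
have [y cy xy] := h _ e2; have [n yn] := cy _ e2; exists n.
by rewrite -(subrK y x) -addrA; apply: le_lt_trans (ler_normD _ _) _; lra.
Qed.

Lemma closure_of_subspace :
  (forall (q : rat) j k, exists n, v n = v j + ratr q *: v k) ->
  is_subspace closure_of.
Proof.
move=> h.
have V0 : exists n, v n = 0.
  by have [n hn] := h (-1) 0%N 0%N; exists n; rewrite hn rmorphN rmorph1 scaleN1r subrr.
split.
- by have [n <-] := V0; exact: closure_of_mem.
- move=> x y cx cy e e0; have e2 : 0 < e / 2 by rewrite divr_gt0.
  have [j xj] := cx _ e2; have [k yk] := cy _ e2; have [n hn] := h 1 j k.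
  exists n; rewrite hn rmorph1 scale1r opprD addrACA.
  by apply: le_lt_trans (ler_normD _ _) _; lra.
- move=> t x cx e e0; have x1 : 0 < `|x| + 1 by rewrite ltr_wpDl.
  have [|q] := @rat_in_itvoo R t (t + e / (2 * (`|x| + 1))).
    by rewrite ltrDl divr_gt0 // mulr_gt0.
  rewrite in_itv /= => /andP[q1 q2].
  have w0 : 0 < `|ratr q : R| + 1 by rewrite ltr_wpDl.
  have [|k xk] := cx (e / (2 * (`|ratr q : R| + 1))); first by rewrite divr_gt0 // mulr_gt0.
  have [j vj] := V0; have [n hn] := h q j k; exists n; rewrite hn vj add0r.
  move: (ratr q : R) q1 q2 w0 xk => u q1 q2 w0 xk {hn}.
  have -> : t *: x - u *: v k = (t - u) *: x + u *: (x - v k).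
    by rewrite scalerBl scalerBr addrA subrK.
  apply: le_lt_trans (ler_normD _ _) _; rewrite !normrZ.
  have A : `|t - u| * (2 * (`|x| + 1)) <= e.
    rewrite -ler_pdivlMr ?mulr_gt0 // ler0_norm ?subr_le0 ?(ltW q1) //.
    by rewrite opprB lerBlDl ltW.
  have B : `|x - v k| * (2 * (`|u| + 1)) < e by rewrite -ltr_pdivlMr ?mulr_gt0.
  move: A B (normr_ge0 (t - u)) (normr_ge0 (x - v k)).
  by move: `|t - u| `|x - v k| `|u| => a b c; lra.
Qed.

End ClosedSpan.

Lemma list_margin (R : realType) (T : eqType) (s : seq T) (P : T -> R) :
  (forall c, c \in s -> 0 < P c) -> exists2 d, 0 < d & forall c, c \in s -> d < P c.
Proof.
elim: s => [|a s IH] h; first by exists 1.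
have [|d d0 hd] := IH; first by move=> c cs; apply: h; rewrite inE cs orbT.
have a0 : 0 < P a by apply: h; rewrite inE eqxx.
exists (Num.min d (P a / 2)); first by rewrite lt_min d0 divr_gt0.
move=> c; rewrite inE => /predU1P[->|/hd cd]; rewrite gt_min.
  by apply/orP; right; lra.
by rewrite cd.
Qed.

(** * Compactness for systems of constraints on functionals *)

Section FiniteSatisfiability.
Variables (R : realType) (X : normedModType R) (m : nat).
Variables (p : X -> R) (eps L : R).

Definition near_sum (q : 'I_m -> X -> R) := (forall i, bounded_lin L (q i)) /\
  forall h, `|p h - \sum_i q i h| <= eps * `|h|.

(* Compactness of the dual ball, through an ultrafilter on finite lists of
   constraints. *)
Lemma finite_satisfiability (Cs : set ('I_m * X * R)) :
  (forall (cs : seq ('I_m * X * R)) t, (forall c, c \in cs -> Cs c) -> 0 < t ->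
    exists2 q, near_sum q & forall c, c \in cs -> q c.1.1 c.1.2 <= c.2 + t) ->
  exists2 q, near_sum q & forall c, Cs c -> q c.1.1 c.1.2 <= c.2.
Proof.
move=> H.
pose T := (seq ('I_m * X * R) * nat)%type.
have /choice[phi hphi] : forall ct : T, exists q, near_sum q /\
    forall c, c \in ct.1 -> Cs c -> q c.1.1 c.1.2 <= c.2 + ct.2.+1%:R^-1.
  move=> [cs t]; have t0 : 0 < t.+1%:R^-1 :> R by rewrite invr_gt0 ltr0n.
  have [|q nq hq] := H [seq c <- cs | `[< Cs c >]] _ _ t0.
    by move=> c; rewrite mem_filter => /andP[/asboolP].
  exists q; split=> // c cs' Cc; apply: hq; rewrite mem_filter cs' andbT.
  exact/asboolP.
pose B (ct : T) := [set ct' : T | {subset ct.1 <= ct'.1} /\ (ct.2 <= ct'.2)%N].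
pose F := [set U : set T | exists ct, B ct `<=` U].
have FF : ProperFilter F.
  apply: Build_ProperFilter_ex.
    by move=> U [ct BU]; exists ct; apply: BU; split.
  split.
  - by exists ([::], 0%N).
  - move=> U U' [[c n] BU] [[c' n'] BU']; exists (c ++ c', maxn n n') => -[d k] [/= dc nk].
    split; [apply: BU|apply: BU']; split=> /=.
    + by move=> x xc; apply: dc; rewrite mem_cat xc.
    + exact: leq_trans (leq_maxl _ _) nk.
    + by move=> x xc; apply: dc; rewrite mem_cat xc orbT.
    + exact: leq_trans (leq_maxr _ _) nk.
  - by move=> U U' UU' [ct BU]; exists ct; exact: subset_trans UU'.
have [U [UU FU]] := ultraFilterLemma FF.
have bphi i ct : bounded_lin L (phi ct i) by case: (hphi ct) => -[].
have /choice[q hq] : forall i, exists q, bounded_lin L q /\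
    forall x e, 0 < e -> U [set t | `|phi t i x - q x| < e].
  by move=> i; have [q bq hq] := ultralimit_lin UU (bphi i); exists q.
have FUP := @filter_ex _ U (@ultra_proper _ _ UU).
exists q.
  split=> [i|h]; first by case: (hq i).
  rewrite -subr_le0; apply: (@le_all_eps _ _ m%:R) => // e e0.
  have [t ht] : exists t, forall i : 'I_m, `|phi t i h - q i h| < e.
    apply: FUP; apply: (@filter_forall _ _ (fun (i : 'I_m) t => `|phi t i h - q i h| < e)).
    by move=> i; exact: (hq i).2.
  have [[_ /(_ h) n1] _] := hphi t.
  have : `|\sum_i phi t i h - \sum_i q i h| <= m%:R * e.
    rewrite -sumrB; apply: le_trans (ler_norm_sum _ _ _) _.
    rewrite mulr_natl -[X in _ *+ X]card_ord -sumr_const.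
    by apply: ler_sum => i _; exact: ltW.
  rewrite !ler_norml => n2; rewrite lerBlDr ler_norml.
  move: n1 n2; rewrite ler_norml => /andP[a1 a2] /andP[b1 b2]; apply/andP; split; lra.
move=> [[i x] b] Cc /=; rewrite -subr_le0; apply: (@le_all_eps _ _ 2) => // e e0.
have [n ne] := ltr_add_invr e0; rewrite add0r in ne.
have [t [[ts tn] tx]] : exists t : T, B ([:: (i, x, b)], n) t /\ `|phi t i x - q i x| < e.
  by apply: FUP; apply: filterI; [apply: FU; exists ([:: (i, x, b)], n)|exact: (hq i).2].
have [_ h1] := hphi t.
have := h1 (i, x, b) (ts _ (mem_head _ _)) Cc => /=.
have : t.2.+1%:R^-1 <= n.+1%:R^-1 :> R by rewrite lef_pV2 ?posrE ?ltr0n // ler_nat.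
move: tx ne; move: (t.2.+1%:R^-1) (n.+1%:R^-1) => u w.
rewrite ltr_norml => /andP[a1 a2]; lra.
Qed.

End FiniteSatisfiability.

Section SeparableReduction.
Variables (R : realType) (X : completeNormedModType R) (m : nat).

(** The functionals [q] found on [V] are replaced by others at the same points [z]. If finitely many
    normality constraints at [z] had no solution, points of [V] could be found that also defeat
    every candidate, yet [q] itself meets the constraints posed by points of [V]. So every finite
    system is solvable, and compactness solves all of them at once. *)
Lemma fuzzy_intersection (i0 : 'I_m) (A : 'I_m -> set X) (xb : X) (p : X -> R)
    (eps r M Lp : R) :
  ~ has_rough X -> (forall i, closed (A i)) -> (forall i, A i xb) ->
  0 <= Lp -> bounded_lin Lp p -> 0 < eps -> 0 < r -> 0 <= M ->
  (forall b : 'I_m -> X, (forall i, A i (b i) /\ `|xb - b i| < r) ->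
    p (b i0 - xb) <= eps * `|b i0 - xb| + M * \sum_i `|b i - b i0|) ->
  exists (z : 'I_m -> X) (q : 'I_m -> X -> R),
  [/\ forall i, A i (z i) /\ `|xb - z i| < r,
    forall i, frechet_normal_cone (A i) (z i) (q i) &
    forall h, `|p h - \sum_i q i h| <= 64 * m%:R * eps * `|h|].
Proof.
move=> NR cA Axb Lp0 bp eps0 r0 M0 H.
pose cst := ('I_m * nat * rat)%type.
pose data := (seq cst * nat * nat)%type.
pose c0 : cst := (i0, 0%N, 0 : rat).
pose Q n := @near_sum R X m p (64 * m%:R * eps) n%:R.
pose nthc (d : data) j := nth c0 d.1.1 j.
(* For [c = (i, k, rho)], [val q a c y <= 0] is the normality inequality at centre [a i] with slope
   [1 / (k + 1)]. *)
pose val (q : 'I_m -> X -> R) (a : 'I_m -> X) (c : cst) y :=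
  q c.1.1 (y - a c.1.1) - `|y - a c.1.1| / c.1.2.+1%:R.
(* Besides the constraint types, the data record the tolerance [1 / (t + 1)] and the norm bound [n].
   They are countable in number, and [Y] fixes one family of defeating points for each centre and
   datum before [V] is built. *)
pose unsat (ad : ('I_m -> X) * data) (ys : nat -> X) :=
  (forall j, (j < size ad.2.1.1)%N -> A (nthc ad.2 j).1.1 (ys j) /\
     `|ys j - ad.1 (nthc ad.2 j).1.1| < ratr (nthc ad.2 j).2) /\
  forall q, Q ad.2.2 q -> ~ forall j, (j < size ad.2.1.1)%N ->
     val q ad.1 (nthc ad.2 j) (ys j) <= ad.2.1.2.+1%:R^-1.
have /choice[Y hY] : forall ad, exists Y, (exists ys, unsat ad ys) -> unsat ad Y.
  move=> ad; have [[ys hys]|N] := pselect (exists ys, unsat ad ys).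
    by exists ys.
  by exists (fun=> xb) => ?; exfalso; apply: N.
pose op (c : nat) (vs : seq X) : X :=
  match (unpickle c : option (rat + data * nat)%type) with
  | Some (inl u) => nth xb vs 0 + ratr u *: nth xb vs 1
  | Some (inr (d, j)) => Y (fun i : 'I_m => nth xb vs i, d) j
  | None => xb
  end.
have [v [[k0 vk0] vop]] := countable_closure xb op.
pose V := closure_of v.
have Vs : is_subspace V.
  apply: closure_of_subspace => u j k.
  have [n hn] := vop (pickle (inl u : rat + data * nat)%type) [:: j; k].
  by exists n; rewrite hn /op pickleK.
have Vxb : V xb by rewrite -vk0; exact: closure_of_mem.
have sa : smooth_approx V (fun x : X => `|x|).
  by apply: (separable_smooth_approx NR Vs (v := v)) => x e; apply.
have [z [q [K [Az [K0 bq] nq sq]]]] :=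
  fuzzy_on_subspace Vs (@closure_of_closed _ _ v) sa cA Vxb Axb Lp0 bp eps0 r0 M0 H.
pose n := Num.bound K; have Kn : K <= n%:R by rewrite ltW // archi_boundP.
have Qq : Q n q.
  split=> // i; split; first by case: (bq i).
  by move=> x; apply: le_trans ((bq i).2 x) _; rewrite ler_wpM2r.
have /choice[del hdel] : forall ik : 'I_m * nat, exists d, 0 < d /\ forall y,
    A ik.1 y -> V y -> `|z ik.1 - y| < d ->
    q ik.1 (y - z ik.1) <= ik.2.+1%:R^-1 * `|y - z ik.1|.
  move=> [i k]; have [|d d0 hd] := nq i (k.+1%:R^-1); first by rewrite invr_gt0 ltr0n.
  by exists d.
pose Cs := [set c : 'I_m * X * R | exists ky : nat * X,
  [/\ A c.1.1 ky.2, `|z c.1.1 - ky.2| < del (c.1.1, ky.1), c.1.2 = ky.2 - z c.1.1 &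
   c.2 = `|ky.2 - z c.1.1| / ky.1.+1%:R]].
have [|q' Qq' hq'] := @finite_satisfiability R X m p (64 * m%:R * eps) n%:R Cs.
  move=> cs tau csC tau0.
  apply: contrapT => N.
  have /choice[f hf] : forall c, exists ky : nat * X, Cs c ->
    [/\ A c.1.1 ky.2, `|z c.1.1 - ky.2| < del (c.1.1, ky.1), c.1.2 = ky.2 - z c.1.1 &
     c.2 = `|ky.2 - z c.1.1| / ky.1.+1%:R].
    move=> c; have [[ky hky]|nC] := pselect (Cs c); first by exists ky.
    by exists (0%N, xb).
  have tau2 : 0 < tau / 2 by rewrite divr_gt0.
  have [t ht] := ltr_add_invr tau2; rewrite add0r in ht.
  pose tau' : R := t.+1%:R^-1; have tau'0 : 0 < tau' by rewrite invr_gt0 ltr0n.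
  have [|s0 s00 hs0] := @list_margin R _ cs (fun c => del (c.1.1, (f c).1) - `|z c.1.1 - (f c).2|).
    by move=> c /csC /hf[_ h _ _]; rewrite subr_gt0.
  have n1 : 0 < n%:R + 1 :> R by rewrite ltr_wpDl.
  (* The first bound leaves room for a rational radius below; the second makes a change of centre
     from [z] to [a] cost at most [tau']. *)
  pose sg := Num.min (s0 / 2) (tau' / (n%:R + 1)).
  have sg0 : 0 < sg by rewrite lt_min !divr_gt0.
  have sgs : sg * 2 <= s0 by rewrite -ler_pdivlMr // ge_min lexx.
  have sgt : sg * (n%:R + 1) <= tau' by rewrite -ler_pdivlMr // ge_min lexx orbT.
  have /choice[nn hnn] : forall i, exists k, `|z i - v k| < sg.
    by move=> i; have [_ Vz _] := Az i; exact: Vz.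
  pose ns := [seq nn i | i <- enum 'I_m].
  pose a (i : 'I_m) := nth xb [seq v k | k <- ns] i.
  have aE i : a i = v (nn i).
    rewrite /a -map_comp (nth_map i0) ?size_enum_ord //.
    by rewrite nth_ord_enum.
  have za i : `|z i - a i| < sg by rewrite aE.
  (* Replacing [z] by [a] changes each constraint by at most [sg * (n + 1)]. *)
  have val_le g c y : Q n g -> val g a c y <= val g z c y + tau' /\
      val g z c y <= val g a c y + tau'.
    move=> [bg _]; rewrite /val; set i := c.1.1.
    have e1 : g i (y - a i) = g i (y - z i) + g i (z i - a i).
      by rewrite -(proj1 (bg i).1) addrA subrK.
    have b1 : `|g i (z i - a i)| <= n%:R * sg.
      by apply: le_trans (bounded_lin_norm _ (bg i)) _; rewrite ler_wpM2l // ltW.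
    have b2 : `| `|y - a i| - `|y - z i| | <= sg.
      apply: le_trans (ler_dist_dist _ _) _.
      by rewrite opprB addrC addrA subrK ltW.
    have c1 : `| `|y - a i| / c.1.2.+1%:R - `|y - z i| / c.1.2.+1%:R| <= sg.
      rewrite -mulrBl normrM; apply: le_trans b2; apply: ler_piMr => //.
      by rewrite ger0_norm ?invr_ge0 // invf_le1 // ler1n.
    move: b1 c1 sgt; rewrite e1 !ler_norml.
    move: (c.1.2.+1%:R^-1 : R) (n%:R : R) => k1 n2 /andP[? ?] /andP[? ?] ?.
    by split; lra.
  (* The lower end admits the original points around the centre [a]; the upper end keeps any points
     chosen around [a] within [del] of [z]. *)
  have /choice[rho hrho] : forall c, exists rho : rat, c \in cs ->
      `|(f c).2 - z c.1.1| + sg < ratr rho < del (c.1.1, (f c).1) - sg.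
    move=> c; have [cc|nc] := boolP (c \in cs); last by exists 0.
    have [|u] := @rat_in_itvoo R (`|(f c).2 - z c.1.1| + sg) (del (c.1.1, (f c).1) - sg).
      by have := hs0 c cc; rewrite distrC; lra.
    by rewrite in_itv /= => hu; exists u.
  pose d : data := ([seq (c.1.1, (f c).1, rho c) | c <- cs], t, n).
  pose cc0 : 'I_m * X * R := (i0, 0, 0).
  have dj j : (j < size cs)%N -> nthc d j =
      ((nth cc0 cs j).1.1, (f (nth cc0 cs j)).1, rho (nth cc0 cs j)).
    by move=> js; rewrite /nthc /d /= (nth_map cc0).
  (* The points of [cs] defeat every candidate at centre [a], since a solution there would solve
     [cs] at [z] up to [2 * tau' < tau]. Hence [Y (a, d)] defeats them too, and it lies in [V]. *)
  have [h1 h2] : unsat (a, d) (Y (a, d)).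
    apply: hY; exists (fun j => (f (nth cc0 cs j)).2); split=> /=.
      move=> j; rewrite size_map => js; rewrite dj //=.
      have jcs := mem_nth cc0 js; have [Ay _ _ _] := hf _ (csC _ jcs); split=> //.
      have /andP[+ _] := hrho _ jcs; apply: le_lt_trans.
      set c := nth cc0 cs j; rewrite -(subrK (z c.1.1) (f c).2) -addrA.
      apply: le_trans (ler_normD _ _) _; rewrite subrK lerD2l ltW //.
    move=> g Qg hg; apply: N; exists g => // c cc.
    have js : (index c cs < size cs)%N by rewrite index_mem.
    have := hg (index c cs); rewrite size_map dj //= nth_index // => /(_ js) h3.
    have [_ _ -> ->] := hf _ (csC _ cc).
    have := (val_le g (c.1.1, (f c).1, rho c) (f c).2 Qg).2; move: h3 ht.
    by rewrite /val /= -/tau'; move: ((f c).1.+1%:R^-1 : R) => k1; lra.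
  apply: (h2 q Qq) => j /= js.
  have [Ay ya] := h1 j js.
  have js' : (j < size cs)%N by move: js; rewrite size_map.
  move: Ay ya; rewrite /= dj //=; set c := nth cc0 cs j => Ay ya.
  have ccs : c \in cs by exact: mem_nth.
  have /andP[_ rd] := hrho _ ccs.
  have Vy : V (Y (a, d) j).
    have [k hk] := vop (pickle (inr (d, j) : rat + data * nat)%type) ns.
    by rewrite /op pickleK in hk; rewrite -hk; exact: closure_of_mem.
  have yz : `|z c.1.1 - Y (a, d) j| < del (c.1.1, (f c).1).
    rewrite -(subrK (a c.1.1) (z c.1.1)) -addrA; apply: le_lt_trans (ler_normD _ _) _.
    by have := za c.1.1; rewrite (distrC (a c.1.1)); lra.
  have := (hdel (c.1.1, (f c).1)).2 _ Ay Vy yz => /= h3.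
  have := (val_le q (c.1.1, (f c).1, rho c) (Y (a, d) j) Qq).1.
  by move: h3; rewrite /val /= -/tau'; move: ((f c).1.+1%:R^-1 : R) => k1; lra.
exists z, q'; split=> [i|i|h].
- by have [? _ ?] := Az i.
- have [bq' _] := Qq'; apply/frechet_normal_coneP; split.
    by apply/dualP; exists n%:R.
  move=> e e0; have [k ke] := ltr_add_invr e0; rewrite add0r in ke.
  exists (del (i, k)); first exact: (hdel (i, k)).1.
  move=> y Ay zy.
  have h1 : q' i (y - z i) <= `|y - z i| / k.+1%:R.
    by apply: (hq' (i, y - z i, `|y - z i| / k.+1%:R)); exists (k, y).
  by apply: le_trans h1 _; rewrite mulrC ler_wpM2r // ltW.
- exact: Qq'.2.
Qed.

End SeparableReduction.

(** * From subtransversality to a penalised inequality *)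

Lemma dist_set_le (R : realType) (X : normedModType R) (x y : X) (S : set X) :
  S y -> dist_set x S <= `|x - y|.
Proof. exact: (inf_img_le (f := fun y => `|x - y|) (c := 0)). Qed.

(** Subtransversality supplies [a] in the intersection within [2 * tau * D] of [b i0]. Normality is
    applied to [a - xb], and boundedness of [p] to [b i0 - a]; both errors are multiples of the
    disagreement [D]. *)
Lemma subtransversal_lagrange (R : realType) (X : normedModType R) (m : nat) (i0 : 'I_m)
    (A : 'I_m -> set X) (xb : X) (p : X -> R) (eps rmax : R) :
  (\bigcap_i A i) xb -> subtransversal A xb ->
  frechet_normal_cone (\bigcap_i A i) xb p -> 0 < eps -> 0 < rmax ->
  exists r M, [/\ 0 < r, r <= rmax, 0 <= M &
  forall b : 'I_m -> X, (forall i, A i (b i) /\ `|xb - b i| < r) ->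
    p (b i0 - xb) <= eps * `|b i0 - xb| + M * \sum_i `|b i - b i0|].
Proof.
move=> Axb [tau [r0 [tau0 r00 st]]] /frechet_normal_coneP[/dualP[Lp Lp0 bp] np] eps0 rm0.
have [d d0 hd] := np eps eps0.
have k0 : 0 < 1 + 4 * tau * m%:R by rewrite ltr_wpDr // !mulr_ge0 // ltW.
(* Within radius [r] one has [D <= 2 * m * r], so [a] is within [r + 4 * tau * m * r] of [xb], the
   range where normality is available. *)
pose r := Num.min (Num.min r0 rmax) (d / (1 + 4 * tau * m%:R)).
have rr : 0 < r by rewrite !lt_min r00 rm0 divr_gt0.
have r_r0 : r <= r0 by rewrite !ge_min lexx.
have r_rm : r <= rmax by rewrite !ge_min lexx orbT.
have r_d : r * (1 + 4 * tau * m%:R) <= d by rewrite -ler_pdivlMr // !ge_min lexx !orbT.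
exists r, ((eps + Lp) * (2 * tau)); split=> //.
  by rewrite !mulr_ge0 ?addr_ge0 // ltW.
move=> b hb; have [Ab0 xb0] := hb i0.
set D := \sum_i `|b i - b i0|.
have D0 : 0 <= D by exact: sumr_ge0.
have DR : D <= m%:R * (2 * r).
  rewrite mulr_natl -[X in _ *+ X]card_ord -sumr_const; apply: ler_sum => i _.
  have [_ xbi] := hb i; rewrite -(subrK xb (b i)) -addrA.
  by apply: le_trans (ler_normD _ _) _; rewrite (distrC (b i)); lra.
have dD : dist_set (b i0) (\bigcap_i A i) <= tau * D.
  apply: le_trans (st (b i0) _) _; first by rewrite -ball_normE /=; lra.
  rewrite ler_pM2l //; apply: ler_sum => i _; rewrite distrC.
  by apply: dist_set_le; case: (hb i).
have [a Aa ba] : exists2 a, (\bigcap_i A i) a & `|b i0 - a| <= 2 * tau * D.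
  (* The factor 2 gives strict slack below the infimum except when [D = 0]; then all [b i] coincide
     and already lie in the intersection. *)
  have [D00|Dn0] := eqVneq D 0.
    exists (b i0); last by rewrite subrr normr0 !mulr_ge0 // ltW.
    move=> i _; suff <- : b i = b i0 by case: (hb i).
    apply/eqP; rewrite -subr_eq0 -normr_le0 -D00 /D (bigD1 i) //= lerDl.
    exact: sumr_ge0.
  have D1 : 0 < D by rewrite lt_neqAle eq_sym Dn0.
  have [|a Aa ha] := @inf_img_lt R _ (\bigcap_i A i) (fun y => `|b i0 - y|) (2 * tau * D) xb Axb.
    apply: le_lt_trans dD _; have := mulr_gt0 tau0 D1; lra.
  by exists a => //; exact: ltW.
have axb : `|a - xb| <= `|b i0 - xb| + 2 * tau * D.
  rewrite -(subrK (b i0) a) -addrA; apply: le_trans (ler_normD _ _) _.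
  by rewrite (distrC a); lra.
have tD : tau * D <= tau * (m%:R * (2 * r)) by rewrite ler_pM2l.
have xb0' : `|b i0 - xb| < r by rewrite distrC.
have axd : `|xb - a| < d by rewrite distrC; lra.
have := hd a Aa axd.
have -> : p (b i0 - xb) = p (a - xb) + p (b i0 - a).
  by rewrite -(proj1 bp.1) [a - xb + _]addrC subrKA.
have := bounded_lin_norm (b i0 - a) bp; rewrite ler_norml => /andP[_ h2].
have := ler_wpM2l Lp0 ba; have := ler_wpM2l (ltW eps0) axb; lra.
Qed.

(** The same [tau] works at [x] on the ball that still fits inside the original one; hence a [delta]
    independent of the tolerance in the second statement. *)
Lemma subtransversal_near (R : realType) (X : normedModType R) (m : nat)
    (A : 'I_m -> set X) (xb : X) : subtransversal A xb ->
  exists2 d, 0 < d & forall x, ball xb d x -> subtransversal A x.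
Proof.
move=> [tau [r [tau0 r0 st]]]; exists r => // x; rewrite -ball_normE /= => xr.
exists tau, (r - `|xb - x|); split=> //; first by rewrite subr_gt0.
move=> y; rewrite -ball_normE /= => xy; apply: st; rewrite -ball_normE /=.
rewrite -(subrK x xb) -addrA; apply: le_lt_trans (ler_normD _ _) _; lra.
Qed.

(** * Assembly of the equivalences *)

Lemma asplund_fuzzy (R : realType) (X : completeNormedModType R) (m : nat)
    (A : 'I_m -> set X) (xb : X) : asplund X -> (0 < m)%N ->
  (forall i, closed (A i)) -> (\bigcap_i A i) xb -> subtransversal A xb ->
  forall eps : R, 0 < eps ->
    frechet_normal_cone (\bigcap_i A i) xb
      `<=` enlargement (fuzzy_cone_sum A xb eps) eps.
Proof.
move=> aX m0 cA Axb st eps eps0 p np.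
have NR : ~ has_rough X by move=> /rough_not_asplund.
pose i0 := Ordinal m0.
have m64 : 0 < 64 * m%:R :> R by rewrite mulr_gt0 // ltr0n.
(* This division cancels the factor [64 * m] of [fuzzy_intersection]. *)
have e0 : 0 < eps / (64 * m%:R) by rewrite divr_gt0.
have [r [M [r0 re M0 H]]] := subtransversal_lagrange i0 Axb st np e0 eps0.
have [/dualP[Lp Lp0 bp] _] := (frechet_normal_coneP _ _ _).1 np.
have Axb' i : A i xb by exact: Axb.
have [z [q [Az nq hq]]] := fuzzy_intersection NR cA Axb' Lp0 bp e0 r0 M0 H.
exists (\sum_i (q i : X -> R^o)).
  exists z; last by exists q.
  by move=> i; have [Ai zi] := Az i; split=> //; rewrite -ball_normE /=; lra.
pose u h := \sum_i q i h.
have lq i : is_lin (q i).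
  by have [/dualP[L _ [li _]] _] := (frechet_normal_coneP _ _ _).1 (nq i).
exists (fun h => eps^-1 * (p h - u h)).
  apply/dual_unit_ballP; split.
    split=> [x y|t x]; rewrite /u.
      rewrite (proj1 bp.1).
      under eq_bigr do rewrite (proj1 (lq _)).
      by rewrite big_split /=; ring.
    rewrite (proj2 bp.1).
    under eq_bigr do rewrite (proj2 (lq _)).
    by rewrite -mulr_sumr; ring.
  move=> x; rewrite mul1r ler_pdivrMl //; apply: le_trans (ler_norm _) _.
  by apply: le_trans (hq x) _; rewrite [64 * m%:R * _]mulrC divfK ?gt_eqF.
apply/funext => h; rewrite !fctE fct_sumE /=.
rewrite -[_ *: _]/(eps * (eps^-1 * (p h - u h))) mulrA divff ?gt_eqF // mul1r /u.
by rewrite addrC subrK.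
Qed.

Unset Implicit Arguments.

Theorem theorem3p2 (R : realType) (X : completeNormedModType R) :
  let statement_i := asplund X in
  let statement_ii :=
    forall (m : nat) (A : 'I_m -> set X) (xbar : X),
      (0 < m)%N ->
      (forall i, A i !=set0) -> (forall i, closed (A i)) ->
      (\bigcap_i A i) xbar -> subtransversal A xbar ->
      exists2 delta : R, 0 < delta &
        forall eps : R, 0 < eps ->
        forall x : X, ((\bigcap_i A i) `&` ball xbar delta) x ->
          frechet_normal_cone (\bigcap_i A i) x
            `<=` enlargement (fuzzy_cone_sum A x eps) eps in
  let statement_iii :=
    forall (m : nat) (A : 'I_m -> set X) (xbar : X),
      (0 < m)%N ->
      (forall i, A i !=set0) -> (forall i, closed (A i)) ->
      (\bigcap_i A i) xbar -> subtransversal A xbar ->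
      forall eps : R, 0 < eps ->
        frechet_normal_cone (\bigcap_i A i) xbar
          `<=` enlargement (fuzzy_cone_sum A xbar eps) eps in
  (statement_i <-> statement_ii) /\ (statement_ii <-> statement_iii).
Proof.
move=> s1 s2 s3.
have s32 : s3 -> s2.
  move=> h m A xb m0 A0 cA Axb st; have [d d0 hd] := subtransversal_near st.
  exists d => // eps eps0 x [Ax xd]; apply: h => //; exact: hd.
have s23 : s2 -> s3.
  move=> h m A xb m0 A0 cA Axb st eps eps0.
  have [d d0 hd] := h m A xb m0 A0 cA Axb st.
  by apply: hd => //; split=> //; exact: ballxx.
have s13 : s1 -> s3.
  by move=> h m A xb m0 _ cA Axb st; exact: asplund_fuzzy.
have s31 : s3 -> s1.
  move=> h; apply: not_rough_asplund => /rough_counterexample.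
  move=> [A [x [r [f [cA Ax st r0 [nf N]]]]]]; apply: N.
  by apply: (h 2%N A x) => // i; exists x; exact: Ax.
by split; split=> [h|h]; [exact/s32/s13|exact/s31/s23|exact: s23|exact: s32].
Qed.
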